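(* Let $X$ be a Banach space, let $A:D(A)\subset X\to X$ be a closed linear operator such that $-A$ generates a compact and exponentially stable analytic semigroup $T(t)$ $(t\ge 0)$ on $X$, and let $\omega,\xi,\tau>0$. Let $\alpha\in[0,1)$, and let $G:\mathbb{R}\times X_\alpha\to X_1$ and $F:\mathbb{R}\times X_\alpha\times X_\alpha\to X$ be continuous functions such that for all $x,x_0,x_1\in X_\alpha$ the maps $t\mapsto G(t,x)$ and $t\mapsto F(t,x_0,x_1)$ are $\omega$-periodic. Assume: (H1$''$) there are positive constants $a_0,a_1$ such that $$\|F(t,x_0,x_1)-F(t,y_0,y_1)\|\le a_0\|x_0-y_0\|_\alpha+a_1\|x_1-y_1\|_\alpha,\qquad t\in\mathbb{R},\ x_0,x_1,y_0,y_1\in X_\alpha;$$ (H2) $G(t,0)=0$ for all $t\in\mathbb{R}$, and there is a constant $L\ge 0$ such that $$\|AG(t,x)-AG(t,y)\|\le L\|x-y\|_\alpha,\qquad t\in\mathbb{R},\ x,y\in X_\alpha;$$ (H3$'$) $CM_\alpha(a_0+a_1+L)\dfrac{\omega^{1-\alpha}}{1-\alpha}+C_{1-\alpha}L<1$, where $C=\|(I-T(\omega))^{-1}\|$. Then the neutral evolution equation with delays $$(u(t)-G(t,u(t-\xi)))'+Au(t)=F(t,u(t),u(t-\tau)),\qquad t\in\mathbb{R},$$ has a unique $\omega$-periodic mild solution $u$.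
   Context: Compact semigroup: $T(t)$ is a compact operator for every $t>0$. Exponentially stable: the growth exponent of $T(t)$ is negative, i.e. there are $M\ge1$, $\nu>0$ with $\|T(t)\|\le Me^{-\nu t}$ for all $t\ge0$; in particular $0\in\rho(A)$ and $I-T(\omega)$ has a bounded inverse. Fractional powers: for $\alpha>0$, $A^{-\alpha}=\frac1{\Gamma(\alpha)}\int_0^\infty t^{\alpha-1}T(t)\,dt$, an injective bounded operator on $X$, and $A^\alpha=(A^{-\alpha})^{-1}$; $A^0=I$. $X_\alpha$ is the Banach space $D(A^\alpha)$ with norm $\|x\|_\alpha=\|A^\alpha x\|$; thus $X_0=X$ and $X_1=D(A)$ with norm $\|Ax\|$. Constants: $C_\beta=\|A^{-\beta}\|$ (operator norm on $X$), so $C_{1-\alpha}=\|A^{\alpha-1}\|$; $M_\alpha>0$ denotes a constant such that $\|A^\alpha T(t)\|\le M_\alpha t^{-\alpha}$ for all $t>0$. $C_\omega(\mathbb{R},X_\alpha)$ is the space of continuous $\omega$-periodic functions $\mathbb{R}\to X_\alpha$ with the maximum norm. An $\omega$-periodic mild solution of the equation is a function $u\in C_\omega(\mathbb{R},X_\alpha)$ such that for all $t\in\mathbb{R}$ $$u(t)=G(t,u(t-\xi))+(I-T(\omega))^{-1}\int_{t-\omega}^{t}T(t-s)\big[F(s,u(s),u(s-\tau))-AG(s,u(s-\xi))\big]ds.$$ (Equivalently, $v(t)=u(t)-G(t,u(t-\xi))$ is the $\omega$-periodic mild solution of $v'(t)+Av(t)=F(t,u(t),u(t-\tau))-AG(t,u(t-\xi))$.)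 *)

(* Defs.v *)
From Stdlib Require Export Reals.
From Coquelicot Require Export Coquelicot.
Open Scope R_scope.

(** Banach spaces are real ([CompleteNormedModule R_AbsRing]).  A complex Banach
    space is covered through its underlying real space: the complexification of
    the latter is [X] plus its conjugate space, so that a complex-linear semigroup
    is analytic on [X] iff it is [analytic_semigroup] below.

    A partial operator is a domain [D : X -> Prop] together with a total function
    [A : X -> X] that is only ever used on [D]; likewise semigroups [T : R -> X -> X]
    are only used at times [t >= 0]. *)

Section Operators.

Context {X : CompleteNormedModule R_AbsRing}.
Implicit Types (D : X -> Prop) (A B : X -> X) (T : R -> X -> X).

(** Value in [Rbar]: [p_infty] when [B] is not bounded. *)
Definition opnorm B : Rbar :=
  Lub_Rbar (fun r => exists x : X, norm x <= 1 /\ r = norm (B x)).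

Definition linear_on D A : Prop :=
  D zero /\
  (forall x y, D x -> D y -> D (plus x y) /\ A (plus x y) = plus (A x) (A y)) /\
  (forall (k : R) x, D x -> D (scal k x) /\ A (scal k x) = scal k (A x)).

Definition closed_operator D A : Prop :=
  closed (fun p : X * X => D (fst p) /\ snd p = A (fst p)).

Definition compact_set (K : X -> Prop) : Prop :=
  forall U : (X -> Prop) -> Prop,
    (forall O, U O -> open O) ->
    (forall x, K x -> exists O, U O /\ O x) ->
    exists l : list (X -> Prop),
      (forall O, List.In O l -> U O) /\
      (forall x, K x -> exists O, List.In O l /\ O x).

Definition closure (S : X -> Prop) (x : X) : Prop :=
  forall P : X -> Prop, locally x P -> exists y, P y /\ S y.

Definition compact_operator B : Prop :=
  is_linear B /\
  compact_set (closure (fun y => exists x : X, norm x <= 1 /\ y = B x)).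

Definition C0_semigroup T : Prop :=
  (forall t, 0 <= t -> is_linear (T t)) /\
  (forall x, T 0 x = x) /\
  (forall s t x, 0 <= s -> 0 <= t -> T (s + t) x = T s (T t x)) /\
  (forall x, filterlim (fun t => T t x) (at_right 0) (locally x)).

Definition generator T (x y : X) : Prop :=
  filterlim (fun h => scal (/ h) (minus (T h x) x)) (at_right 0) (locally y).

(** [- A] with domain [D] is the infinitesimal generator of [T]. *)
Definition neg_generates D A T : Prop :=
  forall x y, generator T x y <-> D x /\ y = opp (A x).

Definition compact_semigroup T : Prop :=
  forall t, 0 < t -> compact_operator (T t).

Definition exponentially_stable T : Prop :=
  exists M nu : R, 1 <= M /\ 0 < nu /\
    forall t, 0 <= t -> forall x, norm (T t x) <= M * exp (- nu * t) * norm x.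

(** Complexification: [(x, y) : X * X] stands for [x + i y]. *)
Definition cscal (c : C) (v : X * X) : X * X :=
  (minus (scal (Re c) (fst v)) (scal (Im c) (snd v)),
   plus (scal (Re c) (snd v)) (scal (Im c) (fst v))).

(** The open sector [|arg z| < atan k]. *)
Definition sector (k : R) (z : C) : Prop := 0 < Re z /\ Rabs (Im z) < k * Re z.

(** Complex differentiability at [z]: the real Frechet derivative at [z] is
    complex multiplication [h |-> h d] by some vector [d]. *)
Definition holomorphic_at (f : C -> X * X) (z : C) : Prop :=
  exists d : X * X,
    filterdiff (U := C_R_NormedModule) (V := prod_NormedModule R_AbsRing X X)
      f (locally z) (fun h => cscal h d).

(** The complexified semigroup extends to a semigroup of bounded complex-linear
    operators, holomorphic on a sector around the positive axis and strongly
    continuous at [0] there. *)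
Definition analytic_semigroup T : Prop :=
  C0_semigroup T /\
  exists (k : R) (S : C -> X * X -> X * X),
    0 < k /\
    (forall z, sector k z ->
       is_linear (U := prod_NormedModule R_AbsRing X X)
                 (V := prod_NormedModule R_AbsRing X X) (S z) /\
       forall v, S z (cscal Ci v) = cscal Ci (S z v)) /\
    (forall t v, 0 <= t -> S (RtoC t) v = (T t (fst v), T t (snd v))) /\
    (forall z w v, sector k z -> sector k w -> S (Cplus z w) v = S z (S w v)) /\
    (forall z v, sector k z -> holomorphic_at (fun w => S w v) z) /\
    (forall v, filterlim (fun z => S z v)
                 (within (sector k) (locally (RtoC 0))) (locally v)).

Definition Gamma (a : R) : R :=
  RInt_gen (fun t => Rpower t (a - 1) * exp (- t)) (at_right 0) (Rbar_locally p_infty).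

(** [A^{-a}] for [a >= 0], where [- A] generates [T]. *)
Definition neg_power T (a : R) (x : X) : X :=
  if Req_EM_T a 0 then x
  else scal (/ Gamma a)
         (RInt_gen (fun t => scal (Rpower t (a - 1)) (T t x))
            (at_right 0) (Rbar_locally p_infty)).

(** [D(A^a)], the carrier of [X_a]. *)
Definition power_dom T (a : R) (x : X) : Prop := exists y, neg_power T a y = x.

(** [A^a x]; meaningful for [x] in [power_dom T a]. *)
Definition power T (a : R) (x : X) : X := iota (fun y : X => neg_power T a y = x).

(** The norm of [X_a]. *)
Definition norm_pow T (a : R) (x : X) : R := norm (power T a x).

(** [(I - T(omega))^{-1}] *)
Definition inv_I_minus T (omega : R) (y : X) : X :=
  iota (fun x : X => minus x (T omega x) = y).

(** Joint continuity of [G : R * X_a -> X_1], [X_1 = D(A)] having norm [|A x|]. *)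
Definition continuous_G D A T (a : R) (G : R -> X -> X) : Prop :=
  (forall t x, power_dom T a x -> D (G t x)) /\
  forall t x, power_dom T a x ->
  forall eps, 0 < eps -> exists delta, 0 < delta /\
  forall s y, power_dom T a y ->
    Rabs (s - t) < delta -> norm_pow T a (minus y x) < delta ->
    norm (A (minus (G s y) (G t x))) < eps.

(** Joint continuity of [F : R * X_a * X_a -> X]. *)
Definition continuous_F T (a : R) (F : R -> X -> X -> X) : Prop :=
  forall t x0 x1, power_dom T a x0 -> power_dom T a x1 ->
  forall eps, 0 < eps -> exists delta, 0 < delta /\
  forall s y0 y1, power_dom T a y0 -> power_dom T a y1 ->
    Rabs (s - t) < delta ->
    norm_pow T a (minus y0 x0) < delta -> norm_pow T a (minus y1 x1) < delta ->
    norm (minus (F s y0 y1) (F t x0 x1)) < eps.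

(** [C_omega(R, X_a)] *)
Definition periodic_continuous T (a omega : R) (u : R -> X) : Prop :=
  (forall t, power_dom T a (u t)) /\
  (forall t, u (t + omega) = u t) /\
  (forall t eps, 0 < eps -> exists delta, 0 < delta /\
     forall s, Rabs (s - t) < delta -> norm_pow T a (minus (u s) (u t)) < eps).

(** [omega]-periodic mild solution of
    [(u(t) - G(t, u(t - xi)))' + A u(t) = F(t, u(t), u(t - tau))]. *)
Definition periodic_mild_solution A T (a omega xi tau : R)
    (G : R -> X -> X) (F : R -> X -> X -> X) (u : R -> X) : Prop :=
  periodic_continuous T a omega u /\
  forall t,
    u t = plus (G t (u (t - xi)))
            (inv_I_minus T omega
               (RInt (fun s => T (t - s)
                        (minus (F s (u s) (u (s - tau))) (A (G s (u (s - xi))))))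
                  (t - omega) t)).

End Operators.

(* Main.v *)
From Stdlib Require Import Lra ClassicalEpsilon FunctionalExtensionality.
Require Import Defs.

(** A function [u] is a periodic mild solution iff [v = A^alpha u] is a continuous
    periodic fixed point of
    [v |-> A^(alpha-1) (A G) + (I - T(omega))^(-1) A^alpha int T(r) f(t - r) dr], which
    is a contraction of ratio the left side of (H3'): the first term uses
    [A^alpha A^(-1) = A^(alpha-1)], and in the second [A^alpha] goes under the integral,
    where [|A^alpha T(r)| <= Malpha r^(-alpha)] is integrable.

    The identity [A^(-a) A^(-b) = A^(-1)] for [a + b = 1] is obtained without a
    Fubini theorem: after rescaling the inner integral,
    [t^(a-1) T(t) int s^(b-1) T(s) x ds = int s^(b-1) T(t(1+s)) x ds], and the
    right-hand side has the explicit antiderivative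
    [- int s^(b-1)/(1+s) T(t(1+s)) A^(-1) x ds] in [t], at first for smooth [x].
    This gives the identity up to the factor [int s^(b-1)/(1+s) ds], which the
    same statement for the scalar semigroup [e^(-t)] identifies as
    [Gamma(a) Gamma(b)]. *)

(** * Identities and norms in Banach spaces *)

(** [power] is a definite description, so [A^alpha x] carries information only on the range of
    [A^(-alpha)]. Hence the passage to [v]: [A^(-alpha)] is an isometry of [X] onto [X_alpha], so
    the fixed point argument runs among continuous periodic functions with values in [X], and
    equalities involving [A^alpha] are proved by applying the injective operator [A^(-alpha)] to
    both sides.

    The product formula yields the injectivity of [A^(-alpha)], the inclusion of [D(A)] in
    [D(A^alpha)], and the identity behind the first term of the map. Analyticity acts through that
    inclusion: orbits are differentiable at positive times, so [T(t) x] lies in [D(A)] and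
    [A^alpha T(t) x] is meaningful.

    A smooth vector is one in the range of [A^(-1)], where orbits are Lipschitz; on the range of
    [A^(-2)] they have a Taylor expansion with quadratic remainder, which is what differentiates the
    improper integral in [t]. The constant of the product formula is a Beta integral, whose
    positivity also shows that the Gamma values do not vanish. *)

Section VectorIdentities.

Context {V : ModuleSpace R_Ring}.

(** Reified linear combinations: atoms are positions in a list, so that an identity of vectors
    follows from equalities of real coefficients, atom by atom. *)
Inductive vexp : Type :=
  | VVar (n : nat) | VZero | VPlus (a b : vexp) | VMinus (a b : vexp)
  | VOpp (a : vexp) | VScal (k : R) (a : vexp).

Fixpoint vden (l : list V) (e : vexp) : V :=
  match e with
  | VVar n => List.nth n l zero
  | VZero => zero
  | VPlus a b => plus (vden l a) (vden l b)
  | VMinus a b => minus (vden l a) (vden l b)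
  | VOpp a => opp (vden l a)
  | VScal k a => scal k (vden l a)
  end.

Fixpoint vcoef (e : vexp) (i : nat) : R :=
  match e with
  | VVar n => if Nat.eqb i n then 1 else 0
  | VZero => 0
  | VPlus a b => vcoef a i + vcoef b i
  | VMinus a b => vcoef a i - vcoef b i
  | VOpp a => - vcoef a i
  | VScal k a => k * vcoef a i
  end.

Fixpoint lincomb (l : list V) (f : nat -> R) : V :=
  match l with
  | nil => zero
  | cons v l' => plus (scal (f O) v) (lincomb l' (fun i => f (S i)))
  end.

Fixpoint all_eq (l : list V) (f g : nat -> R) : Prop :=
  match l with
  | nil => True
  | cons _ l' => f O = g O /\ all_eq l' (fun i => f (S i)) (fun i => g (S i))
  end.

Lemma lincomb_eq l : forall f g, all_eq l f g -> lincomb l f = lincomb l g.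
Proof.
induction l as [|v l IH]; intros f g H; simpl in *; [reflexivity|].
destruct H as [H H']. rewrite H. f_equal. now apply IH.
Qed.

Lemma lincomb_zero l : lincomb l (fun _ => 0) = zero.
Proof.
induction l as [|v l IH]; simpl; [reflexivity|].
rewrite IH, plus_zero_r. exact (scal_zero_l v).
Qed.

Lemma lincomb_plus l : forall f g,
  lincomb l (fun i => f i + g i) = plus (lincomb l f) (lincomb l g).
Proof.
induction l as [|v l IH]; intros f g; simpl.
- now rewrite plus_zero_r.
- rewrite (IH (fun i => f (S i)) (fun i => g (S i))).
  replace (scal (f O + g O) v) with (plus (scal (f O) v) (scal (g O) v))
    by (symmetry; exact (scal_distr_r (f O) (g O) v)).
  rewrite <- !plus_assoc. f_equal. rewrite !plus_assoc. f_equal. apply plus_comm.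
Qed.

Lemma lincomb_scal l k : forall f, lincomb l (fun i => k * f i) = scal k (lincomb l f).
Proof.
induction l as [|v l IH]; intros f; simpl.
- symmetry. exact (scal_zero_r k).
- rewrite (IH (fun i => f (S i))), scal_distr_l. f_equal.
  symmetry. exact (scal_assoc k (f O) v).
Qed.

Lemma lincomb_opp l f : lincomb l (fun i => - f i) = opp (lincomb l f).
Proof.
transitivity (scal (-1) (lincomb l f)).
- rewrite <- lincomb_scal. apply lincomb_eq. generalize f; clear.
  induction l as [|v l IH]; intros f; simpl; [exact I|]. split; [ring|apply (IH (fun i => f (S i)))].
- exact (scal_opp_one (lincomb l f)).
Qed.

Lemma lincomb_var l : forall n,
  lincomb l (fun i => if Nat.eqb i n then 1 else 0) = List.nth n l zero.
Proof.
induction l as [|v l IH]; intros [|n]; simpl; try reflexivity.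
- rewrite lincomb_zero, plus_zero_r. exact (scal_one v).
- rewrite IH. transitivity (plus zero (List.nth n l zero)); [f_equal; exact (scal_zero_l v)|apply plus_zero_l].
Qed.

Lemma vden_lincomb l e : vden l e = lincomb l (vcoef e).
Proof.
induction e as [n| |a IHa b IHb|a IHa b IHb|a IHa|k a IHa]; simpl.
- symmetry. apply lincomb_var.
- symmetry. apply lincomb_zero.
- now rewrite IHa, IHb, <- lincomb_plus.
- unfold minus. rewrite IHa, IHb, <- lincomb_opp, <- lincomb_plus. reflexivity.
- now rewrite IHa, <- lincomb_opp.
- now rewrite IHa, <- lincomb_scal.
Qed.

Lemma vec_eq l a b : all_eq l (vcoef a) (vcoef b) -> vden l a = vden l b.
Proof. intros H. rewrite !vden_lincomb. now apply lincomb_eq. Qed.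

End VectorIdentities.

Ltac vec_mem x l :=
  match l with
  | nil => constr:(false)
  | cons x _ => constr:(true)
  | cons _ ?l' => vec_mem x l'
  end.

Ltac vec_index x l :=
  match l with
  | cons x _ => constr:(O)
  | cons _ ?l' => let n := vec_index x l' in constr:(S n)
  end.

Ltac vec_atoms l e :=
  lazymatch e with
  | plus ?a ?b => let l1 := vec_atoms l a in vec_atoms l1 b
  | minus ?a ?b => let l1 := vec_atoms l a in vec_atoms l1 b
  | opp ?a => vec_atoms l a
  | scal _ ?a => vec_atoms l a
  | zero => l
  | ?x => lazymatch vec_mem x l with
          | true => l
          | false => constr:(cons x l)
          end
  end.

Ltac vec_quote l e :=
  lazymatch e with
  | plus ?a ?b => let u := vec_quote l a in let v := vec_quote l b in constr:(VPlus u v)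
  | minus ?a ?b => let u := vec_quote l a in let v := vec_quote l b in constr:(VMinus u v)
  | opp ?a => let u := vec_quote l a in constr:(VOpp u)
  | scal ?k ?a => let u := vec_quote l a in constr:(VScal k u)
  | zero => constr:(VZero)
  | ?x => let n := vec_index x l in constr:(VVar n)
  end.

(** Reduces an identity between linear combinations of vectors to the real
    identities between their coefficients. *)
Ltac vec_coefs V :=
  match goal with
  | |- ?a = ?b =>
    let l0 := vec_atoms (@nil V) a in
    let l := vec_atoms l0 b in
    let u := vec_quote l a in
    let v := vec_quote l b in
    change (@vden V l u = @vden V l v);
    apply vec_eq; cbn [all_eq vcoef Nat.eqb]; repeat split
  end.

Ltac vec V := vec_coefs V; try ring.

(** [NormedModule] lemmas restated for complete spaces: rewriting does not see
    through the two canonical paths to the group structure. *)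
Section Norm.

Context {V : CompleteNormedModule R_AbsRing}.

Lemma norm_plus_le (x y : V) : norm (plus x y) <= norm x + norm y.
Proof. exact (norm_triangle x y). Qed.

Lemma norm_opp_eq (x : V) : norm (opp x) = norm x.
Proof. exact (norm_opp x). Qed.

Lemma norm_zero_eq : norm (zero : V) = 0.
Proof. exact (norm_zero (V := V)). Qed.

Lemma norm_pos (x : V) : 0 <= norm x.
Proof. exact (norm_ge_0 x). Qed.

(** [norm_scal] is an inequality; the reverse one comes from applying it to [/ k] and [scal k x]. *)
Lemma norm_scal_eq (k : R) (x : V) : norm (scal k x) = Rabs k * norm x.
Proof.
apply Rle_antisym; [exact (norm_scal k x)|].
destruct (Req_dec k 0) as [->|Hk].
- rewrite Rabs_R0, Rmult_0_l. apply norm_pos.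
- replace x with (scal (/ k) (scal k x)) at 1 by (vec V; now field).
  apply Rle_trans with (Rabs k * (Rabs (/ k) * norm (scal k x))).
  + apply Rmult_le_compat_l; [apply Rabs_pos|]. exact (norm_scal (/ k) (scal k x)).
  + rewrite <- Rmult_assoc, <- Rabs_mult, Rinv_r, Rabs_R1 by easy. lra.
Qed.

Lemma norm_minus_sym (x y : V) : norm (minus x y) = norm (minus y x).
Proof. rewrite <- norm_opp_eq. f_equal. vec V. Qed.

Lemma norm_minus_triangle (x y z : V) :
  norm (minus x z) <= norm (minus x y) + norm (minus y z).
Proof.
replace (minus x z) with (plus (minus x y) (minus y z)) by vec V.
apply norm_plus_le.
Qed.

Lemma norm_le_minus (x y : V) : norm x <= norm (minus x y) + norm y.
Proof.
replace x with (plus (minus x y) y) at 1 by vec V. apply norm_plus_le.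
Qed.

Lemma norm_minus_le (x y : V) : norm (minus x y) <= norm x + norm y.
Proof. unfold minus. rewrite <- (norm_opp_eq y). apply norm_plus_le. Qed.

Lemma minus_eq_zero_norm (x y : V) : norm (minus x y) <= 0 -> x = y.
Proof.
intros H. assert (E : minus x y = zero).
{ apply (norm_eq_zero (V := V)). apply Rle_antisym; [exact H|apply norm_ge_0]. }
replace x with (plus (minus x y) y) by vec V. rewrite E. apply plus_zero_l.
Qed.

Lemma eq_of_norm_eps (x y : V) : (forall eps, 0 < eps -> norm (minus x y) < eps) -> x = y.
Proof.
intros H. apply minus_eq_zero_norm. destruct (Rle_or_lt (norm (minus x y)) 0) as [?|h]; [easy|].
specialize (H _ h). lra.
Qed.

End Norm.

Section Epsilon.

Context {V : CompleteNormedModule R_AbsRing}.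
Implicit Types (f g : R -> V).

Lemma filterlim_eps {U : Type} (F : (U -> Prop) -> Prop) {FF : Filter F} (f : U -> V) (l : V) :
  filterlim f F (locally l) <->
  forall eps, 0 < eps -> F (fun x => norm (minus (f x) l) < eps).
Proof.
split.
- intros H eps He. exact (proj1 (filterlim_locally_ball_norm f l) H (mkposreal eps He)).
- intros H. apply (proj2 (filterlim_locally_ball_norm (U := V) f l)).
  intros eps. exact (H eps (cond_pos eps)).
Qed.

Lemma continuous_eps f (t : R) :
  continuous f t <->
  forall eps, 0 < eps -> exists d, 0 < d /\
    forall s, Rabs (s - t) < d -> norm (minus (f s) (f t)) < eps.
Proof.
unfold continuous. rewrite (filterlim_eps (locally t)). split.
- intros H eps He. destruct (H eps He) as [d Hd].
  exists d. split; [apply cond_pos|]. intros s Hs. apply Hd. exact Hs.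
- intros H eps He. destruct (H eps He) as [d [Hd H']].
  exists (mkposreal d Hd). intros s Hs. apply H'. exact Hs.
Qed.

Lemma is_derive_eps f (t : R) (l : V) :
  (forall eps, 0 < eps -> exists d, 0 < d /\ forall h, Rabs h < d ->
     norm (minus (minus (f (t + h)) (f t)) (scal h l)) <= eps * Rabs h) ->
  is_derive f t l.
Proof.
intros H. split; [apply is_linear_scal_l|].
intros x Hx eps. apply (is_filter_lim_locally_unique (V := R_NormedModule)) in Hx. subst x.
destruct (H eps (cond_pos eps)) as [d [Hd H']].
exists (mkposreal d Hd). intros s Hs.
specialize (H' (s - t) Hs). rewrite (Rplus_minus t s) in H'. exact H'.
Qed.

Lemma at_right_eps (P : R -> Prop) :
  at_right 0 P <-> exists d, 0 < d /\ forall h, 0 < h < d -> P h.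
Proof.
split.
- intros [d Hd]. exists d. split; [apply cond_pos|]. intros h [h0 h1].
  apply Hd; [|exact h0]. change (Rabs (h - 0) < d). rewrite Rminus_0_r, Rabs_pos_eq; lra.
- intros [d [Hd H]]. exists (mkposreal d Hd). intros y Hy y0. apply H. split; [exact y0|].
  change (Rabs (y - 0) < d) in Hy. rewrite Rminus_0_r, Rabs_pos_eq in Hy; lra.
Qed.

End Epsilon.

Section BoundedLinear.

Context {U V : CompleteNormedModule R_AbsRing}.

Lemma lin_intro (B : U -> V) (C : R) :
  (forall x y : U, B (plus x y) = plus (B x) (B y)) ->
  (forall (k : R) (x : U), B (scal k x) = scal k (B x)) ->
  (forall x : U, norm (B x) <= C * norm x) -> is_linear B.
Proof.
intros H1 H2 H3. split; [exact H1|exact H2|]. exists (Rmax C 1).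
split; [apply Rlt_le_trans with (2 := Rmax_r C 1); lra|].
intros x. apply Rle_trans with (1 := H3 x).
apply Rmult_le_compat_r; [apply (norm_pos (V := U))|apply Rmax_l].
Qed.

Lemma lin_plus (B : U -> V) (HB : is_linear B) (x y : U) : B (plus x y) = plus (B x) (B y).
Proof. exact (linear_plus B HB x y). Qed.

Lemma lin_minus (B : U -> V) (HB : is_linear B) (x y : U) : B (minus x y) = minus (B x) (B y).
Proof. exact (linear_minus B x y HB). Qed.

Lemma lin_scal (B : U -> V) (HB : is_linear B) (k : R) (x : U) : B (scal k x) = scal k (B x).
Proof. exact (linear_scal B HB k x). Qed.

Lemma lin_zero (B : U -> V) (HB : is_linear B) : B zero = zero.
Proof. exact (linear_zero B HB). Qed.

Lemma Riemann_sum_linear_map (B : U -> V) (HB : is_linear B) (f : R -> U) (ptd : @SF_seq R) :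
  Riemann_sum (fun t => B (f t)) ptd = B (Riemann_sum f ptd).
Proof.
induction ptd as [x0|h s IH] using SF_cons_ind.
- unfold Riemann_sum; simpl. symmetry. exact (linear_zero B HB).
- rewrite !Riemann_sum_cons, IH. symmetry.
  etransitivity; [exact (linear_plus B HB _ _)|]. f_equal. exact (linear_scal B HB _ _).
Qed.

Lemma is_RInt_linear_map (B : U -> V) (HB : is_linear B) (f : R -> U) (a b : R) (l : U) :
  is_RInt f a b l -> is_RInt (fun t => B (f t)) a b (B l).
Proof.
intros H. unfold is_RInt.
apply filterlim_ext with (fun ptd => B (scal (sign (b - a)) (Riemann_sum f ptd))).
- intros ptd. rewrite (Riemann_sum_linear_map B HB). exact (linear_scal B HB _ _).
- eapply filterlim_comp; [exact H|]. exact (linear_cont B l HB).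
Qed.

End BoundedLinear.

(** * Improper integrals on the half-line *)

Lemma Rpower_pos (x y : R) : 0 < Rpower x y.
Proof. apply exp_pos. Qed.

Lemma is_derive_Rpower (a t : R) : 0 < t ->
  is_derive (fun x => Rpower x a) t (a * Rpower t (a - 1)).
Proof. intros Ht. apply is_derive_Reals. now apply derivable_pt_lim_power. Qed.

Lemma continuous_Rpower (a t : R) : 0 < t -> continuous (fun x => Rpower x a) t.
Proof.
intros Ht. apply (ex_derive_continuous (V := R_NormedModule)).
eexists. now apply is_derive_Rpower.
Qed.

Lemma is_RInt_Rpower (K a s t : R) : a <> 0 -> 0 < s -> 0 < t ->
  is_RInt (fun x => K * Rpower x (a - 1)) s t (K / a * (Rpower t a - Rpower s a)).
Proof.
intros Ha Hs Ht.
replace (K / a * (Rpower t a - Rpower s a))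
  with (minus (K / a * Rpower t a) (K / a * Rpower s a))
  by (unfold minus, plus, opp; simpl; ring).
assert (Hp : forall x, Rmin s t <= x -> 0 < x).
{ intros x Hx. apply Rlt_le_trans with (2 := Hx). now apply Rmin_glb_lt. }
apply (is_RInt_derive (V := R_CompleteNormedModule) (fun x => K / a * Rpower x a)).
- intros x [Hx _].
  replace (K * Rpower x (a - 1)) with (K / a * (a * Rpower x (a - 1))) by (now field).
  apply (is_derive_scal (fun x => Rpower x a)). now apply is_derive_Rpower, Hp.
- intros x [Hx _]. apply (continuous_scal_r (V := R_NormedModule) K (fun x => Rpower x (a - 1))).
  now apply continuous_Rpower, Hp.
Qed.

Lemma exp_le_compat (x y : R) : x <= y -> exp x <= exp y.
Proof. intros [H|H]; [left; now apply exp_increasing|rewrite H; apply Rle_refl]. Qed.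

(** The constant is the maximum of [t^c e^(-mu t)], attained at [t = c / mu]; the exponents are
    compared by the tangent inequality [ln u <= u - 1] at [u = mu t / c]. *)
Lemma Rpower_exp_bound (c mu : R) : 0 < c -> 0 < mu ->
  exists K, 0 < K /\ forall t, 0 < t -> Rpower t c * exp (- mu * t) <= K.
Proof.
intros Hc Hmu. exists (exp (c * ln (c / mu) - c)). split; [apply exp_pos|].
intros t Ht. unfold Rpower. rewrite <- exp_plus.
assert (H : ln (mu * t / c) <= mu * t / c - 1).
{ assert (Hp : 0 < mu * t / c) by (apply Rdiv_lt_0_compat; nra).
  rewrite <- (exp_ln _ Hp) at 2. generalize (exp_ineq1_le (ln (mu * t / c))). lra. }
assert (E : ln t = ln (mu * t / c) + ln (c / mu)).
{ rewrite <- ln_mult; [f_equal; field; lra| |].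
  - apply Rdiv_lt_0_compat; nra.
  - now apply Rdiv_lt_0_compat. }
assert (H' : c * ln (mu * t / c) <= mu * t - c).
{ apply Rle_trans with (c * (mu * t / c - 1)); [apply Rmult_le_compat_l; lra|].
  right. field. lra. }
rewrite E. apply exp_le_compat. lra.
Qed.

Notation is_iint f l := (is_RInt_gen f (at_right 0) (Rbar_locally p_infty) l).

Section ImproperIntegral.

Context {V : CompleteNormedModule R_AbsRing}.
Implicit Types (f g : R -> V) (l : V).

(** A single parameter governs both ends: the lower limit lies below [d], the upper one beyond
    [/ d]. *)
Lemma is_iint_eps f l :
  is_iint f l <->
  forall eps, 0 < eps -> exists d, 0 < d /\ forall a b, 0 < a < d -> / d < b ->
    exists y : V, is_RInt f a b y /\ norm (minus y l) < eps.
Proof.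
split.
- intros H eps He.
  destruct (H (fun y => norm (minus y l) < eps)) as [Q S HQ HS HQS].
  { apply locally_le_locally_norm. exists (mkposreal eps He). intros y Hy. exact Hy. }
  apply at_right_eps in HQ. destruct HQ as [d [Hd HQ]]. destruct HS as [M HM].
  assert (HM' : 0 < / (Rabs M + 1)).
  { apply Rinv_0_lt_compat. generalize (Rabs_pos M). lra. }
  exists (Rmin d (/ (Rabs M + 1))). split; [now apply Rmin_glb_lt|].
  intros a b Ha Hb. apply HQS.
  + apply HQ. generalize (Rmin_l d (/ (Rabs M + 1))). lra.
  + apply HM. apply Rle_lt_trans with (2 := Hb).
    apply Rle_trans with (Rabs M + 1); [generalize (Rle_abs M); lra|].
    apply Rle_trans with (/ / (Rabs M + 1)); [rewrite Rinv_inv; apply Rle_refl|].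
    apply Rinv_le_contravar; [now apply Rmin_glb_lt|apply Rmin_r].
- intros H P HP. apply locally_norm_le_locally in HP. destruct HP as [eps HP].
  destruct (H eps (cond_pos eps)) as [d [Hd H']].
  exists (fun a => 0 < a < d) (fun b => / d < b).
  + apply at_right_eps. exists d. now split.
  + exists (/ d). now intros.
  + intros a b Ha Hb. destruct (H' a b Ha Hb) as [y [Hy Hn]].
    exists y. split; [exact Hy|]. apply HP. exact Hn.
Qed.

Lemma iint_unique f l : is_iint f l ->
  RInt_gen f (at_right 0) (Rbar_locally p_infty) = l.
Proof. apply is_RInt_gen_unique. Qed.

Lemma is_iint_ext f g l : (forall t, 0 < t -> f t = g t) -> is_iint f l -> is_iint g l.
Proof.
intros H Hf. rewrite is_iint_eps in *. intros eps He.
destruct (Hf eps He) as [d [Hd H']]. exists d. split; [exact Hd|].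
intros a b Ha Hb. destruct (H' a b Ha Hb) as [y [Hy Hn]]. exists y. split; [|exact Hn].
apply is_RInt_ext with f; [|exact Hy].
intros x [Hx _]. apply H. apply Rlt_trans with (2 := Hx).
apply Rmin_glb_lt; [lra|]. apply Rlt_trans with (2 := Hb). now apply Rinv_0_lt_compat.
Qed.

Lemma is_iint_scal f (k : R) l : is_iint f l -> is_iint (fun t => scal k (f t)) (scal k l).
Proof. apply (is_RInt_gen_scal f k l). Qed.

Lemma is_iint_plus f g l l' :
  is_iint f l -> is_iint g l' -> is_iint (fun t => plus (f t) (g t)) (plus l l').
Proof. apply (is_RInt_gen_plus f g l l'). Qed.

Lemma is_iint_minus f g l l' :
  is_iint f l -> is_iint g l' -> is_iint (fun t => minus (f t) (g t)) (minus l l').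
Proof. intros H H'. apply is_iint_plus; [exact H|]. now apply (is_RInt_gen_opp g l'). Qed.

Lemma is_iint_scale f (c : R) l : 0 < c ->
  is_iint f l -> is_iint (fun t => scal c (f (c * t))) l.
Proof.
intros Hc Hf. rewrite is_iint_eps in *. intros eps He.
destruct (Hf eps He) as [d [Hd H']].
(* After multiplication by [c] the endpoints must still lie below [d] and beyond [/ d]; each
   condition asks for one of the two terms. *)
assert (Hm : 0 < Rmin (d / c) (d * c)).
{ apply Rmin_glb_lt; [now apply Rdiv_lt_0_compat|nra]. }
exists (Rmin (d / c) (d * c)). split; [exact Hm|].
intros a b Ha Hb.
assert (Ha' : c * a < d).
{ apply Rlt_le_trans with (c * (d / c)); [|right; field; lra].
  apply Rmult_lt_compat_l; [exact Hc|]. generalize (Rmin_l (d / c) (d * c)). lra. }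
assert (Hb' : / d < c * b).
{ apply Rle_lt_trans with (c * / (d * c)); [right; field; lra|].
  apply Rmult_lt_compat_l; [exact Hc|]. apply Rle_lt_trans with (2 := Hb).
  apply Rinv_le_contravar; [exact Hm|apply Rmin_r]. }
destruct (H' (c * a) (c * b)) as [y [Hy Hn]].
{ split; [nra|exact Ha']. }
{ exact Hb'. }
exists y. split; [|exact Hn].
apply is_RInt_ext with (fun t => scal c (f (c * t + 0))).
{ intros x _. now rewrite Rplus_0_r. }
apply (is_RInt_comp_lin f c 0 a b). now rewrite !Rplus_0_r.
Qed.

(** Integrable at [0] because of the first bound, at infinity because of the second. *)
Definition dominated (K a : R) f : Prop :=
  forall t, 0 < t ->
    norm (f t) <= K * Rpower t (a - 1) /\ norm (f t) <= K * Rpower t (- a - 1).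

Definition continuous_pos f : Prop := forall t, 0 < t -> continuous f t.

Lemma ex_RInt_pos f s t : continuous_pos f -> 0 < s -> 0 < t -> ex_RInt f s t.
Proof.
intros H Hs Ht. apply (ex_RInt_continuous f). intros x [Hx _]. apply H.
apply Rlt_le_trans with (2 := Hx). now apply Rmin_glb_lt.
Qed.

(** Each half of [dominated] is integrated explicitly: the first gives a bound that vanishes when
    both endpoints tend to 0, the second one that vanishes when both tend to infinity. *)
Lemma norm_RInt_dominated f K a s t : 0 < a -> 0 <= K -> continuous_pos f -> dominated K a f ->
  0 < s -> 0 < t -> norm (RInt f s t) <= K / a * Rpower (Rmax s t) a /\
                    norm (RInt f s t) <= K / a * Rpower (Rmin s t) (- a).
Proof.
intros Ha HK Hc Hd.
assert (Hle : forall s t, 0 < s -> s <= t ->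
  norm (RInt f s t) <= K / a * Rpower t a /\ norm (RInt f s t) <= K / a * Rpower s (- a)).
{ clear s t. intros s t Hs Hst.
  assert (Ht : 0 < t) by lra.
  assert (HI : is_RInt f s t (RInt f s t)) by (apply (RInt_correct f); now apply ex_RInt_pos).
  assert (HKa : 0 <= K / a) by (apply Rdiv_le_0_compat; lra).
  split.
  - apply Rle_trans with (K / a * (Rpower t a - Rpower s a)).
    + apply (norm_RInt_le f (fun x => K * Rpower x (a - 1)) s t); [exact Hst| |exact HI|].
      * intros x Hx. apply Hd. lra.
      * apply is_RInt_Rpower; lra.
    + apply Rmult_le_compat_l; [exact HKa|]. generalize (Rpower_pos s a). lra.
  - apply Rle_trans with (K / (- a) * (Rpower t (- a) - Rpower s (- a))).
    + apply (norm_RInt_le f (fun x => K * Rpower x (- a - 1)) s t); [exact Hst| |exact HI|].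
      * intros x Hx. apply Hd. lra.
      * apply is_RInt_Rpower; lra.
    + replace (K / (- a) * (Rpower t (- a) - Rpower s (- a)))
        with (K / a * (Rpower s (- a) - Rpower t (- a))) by (field; lra).
      apply Rmult_le_compat_l; [exact HKa|]. generalize (Rpower_pos t (- a)). lra. }
intros Hs Ht. destruct (Rle_or_lt s t) as [h|h].
- rewrite Rmax_right, Rmin_left by lra. now apply Hle.
- rewrite Rmax_left, Rmin_right by lra.
  replace (norm (RInt f s t)) with (norm (RInt f t s)); [apply Hle; lra|].
  rewrite <- (norm_opp_eq (RInt f t s)). f_equal.
  exact (opp_RInt_swap f t s (ex_RInt_pos f t s Hc Ht Hs)).
Qed.

Lemma ex_iint_dominated f K a : 0 < a -> 0 <= K -> continuous_pos f -> dominated K a f ->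
  exists l, is_iint f l.
Proof.
intros Ha HK Hc Hd.
destruct (proj1 (filterlim_locally_cauchy (U := V)
   (F := filter_prod (at_right 0) (Rbar_locally p_infty))
   (fun ab : R * R => RInt f (fst ab) (snd ab)))) as [l Hl].
- intros eps.
  pose (e := eps * a / (4 * (K + 1))).
  assert (He : 0 < e).
  { unfold e. generalize (cond_pos eps). intros. apply Rdiv_lt_0_compat; nra. }
  (* With this choice [d^a = e] and [(/ d)^(-a) = e], so the same [d] makes the tail at 0 and the
     tail at infinity at most [K / a * e], which is below [eps / 2]. *)
  pose (d := Rpower e (/ a)).
  assert (Hd0 : 0 < d) by apply Rpower_pos.
  assert (Hda : Rpower d a = e).
  { unfold d. rewrite Rpower_mult, Rinv_l, Rpower_1; lra. }
  assert (Hda' : Rpower (/ d) (- a) = e).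
  { rewrite Rpower_Ropp, <- Hda. unfold Rpower. rewrite ln_Rinv by easy.
    rewrite <- exp_Ropp. f_equal. ring. }
  assert (Hke : K / a * e < eps / 2).
  { unfold e. replace (K / a * (eps * a / (4 * (K + 1)))) with (eps / 2 * (K / (2 * (K + 1)))) by (field; lra).
    generalize (cond_pos eps). intros Hp.
    assert (K / (2 * (K + 1)) < 1).
    { apply Rmult_lt_reg_r with (2 * (K + 1)); [lra|]. field_simplify; lra. }
    nra. }
  assert (HKa : 0 <= K / a) by (apply Rdiv_le_0_compat; lra).
  assert (Hid : 0 < / d) by now apply Rinv_0_lt_compat.
  exists (fun ab : R * R => 0 < fst ab < d /\ / d < snd ab). split.
  + exists (fun x => 0 < x < d) (fun y => / d < y).
    * apply at_right_eps. exists d. now split.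
    * exists (/ d). now intros.
    * intros x y Hx Hy. simpl. now split.
  + intros [u1 u2] [v1 v2]. cbn [fst snd]. intros [Hu1 Hu2] [Hv1 Hv2].
    apply (norm_compat1 (V := V)).
    assert (E : minus (RInt f v1 v2) (RInt f u1 u2) = plus (RInt f v1 u1) (RInt f u2 v2)).
    { rewrite <- (RInt_Chasles f v1 u1 v2) by (apply ex_RInt_pos; auto; lra).
      rewrite <- (RInt_Chasles f u1 u2 v2) by (apply ex_RInt_pos; auto; lra).
      vec V. }
    apply Rle_lt_trans with (1 := Req_le _ _ (f_equal norm E)).
    apply Rle_lt_trans with (1 := norm_plus_le _ _).
    assert (B1 : norm (RInt f v1 u1) <= K / a * e).
    { apply Rle_trans with (K / a * Rpower (Rmax v1 u1) a).
      - apply norm_RInt_dominated; auto; lra.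
      - apply Rmult_le_compat_l; [easy|]. rewrite <- Hda. apply Rle_Rpower_l; [lra|].
        split; [apply Rlt_le_trans with v1; [lra|apply Rmax_l]|]. apply Rmax_lub; lra. }
    assert (B2 : norm (RInt f u2 v2) <= K / a * e).
    { apply Rle_trans with (K / a * Rpower (Rmin u2 v2) (- a)).
      - apply norm_RInt_dominated; auto; lra.
      - apply Rmult_le_compat_l; [easy|]. rewrite <- Hda', !Rpower_Ropp.
        apply Rinv_le_contravar; [apply Rpower_pos|].
        apply Rle_Rpower_l; [lra|]. split; [lra|]. apply Rmin_glb; lra. }
    lra.
- exists l. apply is_iint_eps. intros eps He.
  apply (proj1 (filterlim_eps _ _ _)) with (eps := eps) in Hl; [|exact He].
  destruct Hl as [Q S HQ [M HM] HQS].
  apply at_right_eps in HQ. destruct HQ as [d [Hd0 HQ]].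
  assert (HM' : 0 < / (Rabs M + 1)).
  { apply Rinv_0_lt_compat. generalize (Rabs_pos M). lra. }
  exists (Rmin d (/ (Rabs M + 1))).
  assert (Hm : 0 < Rmin d (/ (Rabs M + 1))) by now apply Rmin_glb_lt.
  split; [exact Hm|].
  intros x y Hx Hy.
  assert (0 < / Rmin d (/ (Rabs M + 1))) by now apply Rinv_0_lt_compat.
  exists (RInt f x y). split.
  + apply (RInt_correct f). apply ex_RInt_pos; [exact Hc| |]; lra.
  + apply (HQS x y).
    * apply HQ. generalize (Rmin_l d (/ (Rabs M + 1))). lra.
    * apply HM. apply Rle_lt_trans with (2 := Hy).
      apply Rle_trans with (Rabs M + 1); [generalize (Rle_abs M); lra|].
      apply Rle_trans with (/ / (Rabs M + 1)); [rewrite Rinv_inv; apply Rle_refl|].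
      apply Rinv_le_contravar; [exact Hm|apply Rmin_r].
Qed.

(** The integral is split at 1; each of the two pieces contributes at most [K / a], by the bound
    suited to its end. *)
Lemma norm_iint_dominated f K a l : 0 < a -> 0 <= K -> continuous_pos f -> dominated K a f ->
  is_iint f l -> norm l <= 2 * K / a.
Proof.
intros Ha HK Hc Hd Hl. apply Rle_plus_epsilon. intros eps He.
destruct (proj1 (is_iint_eps f l) Hl eps He) as [d [Hd0 H]].
assert (Hm : 0 < Rmin d 1) by (apply Rmin_glb_lt; lra).
assert (Hx := Rmin_l d 1). assert (Hx' := Rmin_r d 1).
assert (Hid : 0 < / d) by now apply Rinv_0_lt_compat.
destruct (H (Rmin d 1 / 2) (/ d + 1)) as [y [Hy Hn]]; [lra|lra|].
apply is_RInt_unique in Hy.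
rewrite <- (RInt_Chasles f _ 1 _) in Hy by (apply ex_RInt_pos; auto; lra).
assert (B1 := proj1 (norm_RInt_dominated f K a (Rmin d 1 / 2) 1 Ha HK Hc Hd ltac:(lra) ltac:(lra))).
assert (B2 := proj2 (norm_RInt_dominated f K a 1 (/ d + 1) Ha HK Hc Hd ltac:(lra) ltac:(lra))).
rewrite Rmax_right in B1 by lra. rewrite Rmin_left in B2 by lra.
unfold Rpower in B1, B2. rewrite ln_1, Rmult_0_r, exp_0 in B1, B2.
assert (B3 := norm_le_minus l y). rewrite norm_minus_sym in B3.
assert (B4 := norm_plus_le (RInt f (Rmin d 1 / 2) 1) (RInt f 1 (/ d + 1))).
rewrite Hy in B4.
replace (2 * K / a) with (K / a * 1 + K / a * 1) by (field; lra).
eapply Rle_trans; [exact B3|].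
apply Rle_trans with (eps + (norm (RInt f (Rmin d 1 / 2) 1) + norm (RInt f 1 (/ d + 1)))).
- apply Rplus_le_compat; [now left|exact B4].
- lra.
Qed.

End ImproperIntegral.

Lemma is_iint_linear_map {U V : CompleteNormedModule R_AbsRing} (B : U -> V) (HB : is_linear B)
  (f : R -> U) (l : U) : is_iint f l -> is_iint (fun t => B (f t)) (B l).
Proof.
intros Hf. apply is_iint_eps. intros eps He.
destruct (linear_norm B HB) as [M [HM Hb]].
destruct (proj1 (is_iint_eps f l) Hf (eps / M)) as [d [Hd H]]; [now apply Rdiv_lt_0_compat|].
exists d. split; [exact Hd|]. intros a b Ha Hb'. destruct (H a b Ha Hb') as [y [Hy Hn]].
exists (B y). split; [now apply is_RInt_linear_map|].
rewrite <- (lin_minus B HB y l). apply Rle_lt_trans with (1 := Hb (minus y l)).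
apply Rmult_lt_reg_l with (/ M); [now apply Rinv_0_lt_compat|].
rewrite <- Rmult_assoc, Rinv_l, Rmult_1_l by lra. now rewrite Rmult_comm.
Qed.

(** * Exponentially stable semigroups *)

Section RIntBounds.

Context {V : CompleteNormedModule R_AbsRing}.

Lemma norm_RInt_le_abs (f : R -> V) (a b C : R) (l : V) :
  (forall x, Rmin a b <= x <= Rmax a b -> norm (f x) <= C) ->
  is_RInt f a b l -> norm l <= Rabs (b - a) * C.
Proof.
intros H Hl. destruct (Rle_or_lt a b) as [h|h].
- rewrite Rabs_pos_eq by lra. rewrite Rmin_left, Rmax_right in H by lra.
  exact (norm_RInt_le_const f a b l C h H Hl).
- rewrite Rabs_left by lra. rewrite Rmin_right, Rmax_left in H by lra.
  rewrite <- norm_opp_eq. replace (- (b - a)) with (a - b) by ring.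
  apply (norm_RInt_le_const f b a (opp l) C); [lra|exact H|].
  exact (is_RInt_swap f b a l Hl).
Qed.

End RIntBounds.

Section Semigroup.

Context {X : CompleteNormedModule R_AbsRing} (T : R -> X -> X).
Context (HT : C0_semigroup T) (M nu : R) (HM : 1 <= M) (Hnu : 0 < nu).
Context (Hstable : forall t, 0 <= t -> forall x, norm (T t x) <= M * exp (- nu * t) * norm x).

Lemma sg_linear t : 0 <= t -> is_linear (T t).
Proof. apply HT. Qed.

Lemma sg_zero x : T 0 x = x.
Proof. apply HT. Qed.

Lemma sg_add s t x : 0 <= s -> 0 <= t -> T (s + t) x = T s (T t x).
Proof. apply HT. Qed.

Lemma sg_comm s t x : 0 <= s -> 0 <= t -> T s (T t x) = T t (T s x).
Proof. intros Hs Ht. rewrite <- !sg_add by easy. now rewrite Rplus_comm. Qed.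

Lemma sg_norm t x : 0 <= t -> norm (T t x) <= M * norm x.
Proof.
intros Ht. apply Rle_trans with (1 := Hstable t Ht x).
apply Rmult_le_compat_r; [apply norm_pos|].
rewrite <- (Rmult_1_r M) at 2. apply Rmult_le_compat_l; [lra|].
rewrite <- exp_0. apply exp_le_compat. nra.
Qed.

Lemma sg_norm_mono r0 r x : 0 <= r0 <= r -> norm (T r x) <= M * exp (- nu * r0) * norm x.
Proof.
intros Hr. apply Rle_trans with (1 := Hstable r ltac:(lra) x).
apply Rmult_le_compat_r; [apply norm_pos|]. apply Rmult_le_compat_l; [lra|].
apply exp_le_compat. nra.
Qed.

Lemma sg_near_zero x eps : 0 < eps ->
  exists d, 0 < d /\ forall h, 0 <= h < d -> norm (minus (T h x) x) < eps.
Proof.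
intros He. destruct HT as [_ [_ [_ Hc]]].
assert (H := proj1 (filterlim_eps _ _ _) (Hc x) eps He).
apply at_right_eps in H. destruct H as [d [Hd H]].
exists d. split; [exact Hd|]. intros h [Hh Hhd].
destruct (Req_dec h 0) as [->|Hn].
- rewrite sg_zero. replace (minus x x) with (zero : X) by vec X. now rewrite norm_zero_eq.
- apply H. lra.
Qed.

(** The operator at the smaller time factors out and costs [M], which reduces continuity at any time
    to continuity at 0. *)
Lemma sg_diff s t x : 0 <= s -> 0 <= t ->
  norm (minus (T t x) (T s x)) <= M * norm (minus (T (Rabs (t - s)) x) x).
Proof.
assert (H : forall s t, 0 <= s -> s <= t ->
  norm (minus (T t x) (T s x)) <= M * norm (minus (T (Rabs (t - s)) x) x)).
{ clear s t. intros s t Hs Hst. rewrite Rabs_pos_eq by lra.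
  replace t with (s + (t - s)) at 1 by ring. rewrite sg_add by lra.
  rewrite <- lin_minus by (now apply sg_linear). now apply sg_norm. }
intros Hs Ht. destruct (Rle_or_lt s t) as [h|h]; [now apply H|].
rewrite norm_minus_sym, Rabs_minus_sym. apply H; lra.
Qed.

(** The difference is split at [T (phi s) (g t)]: one part is controlled by the uniform bound [M],
    the other by [sg_diff]. Nonnegativity of [phi] is asked near [t] because [T] carries no
    information at negative times. *)
Lemma continuous_sg (phi : R -> R) (g : R -> X) (t d0 : R) :
  0 < d0 -> (forall s, Rabs (s - t) < d0 -> 0 <= phi s) ->
  continuous phi t -> continuous g t -> continuous (fun s => T (phi s) (g s)) t.
Proof.
intros Hd0 Hpos Hphi Hg. apply continuous_eps. intros eps He.
assert (Ht : 0 <= phi t) by (apply Hpos; now rewrite Rminus_diag, Rabs_R0).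
destruct (sg_near_zero (g t) (eps / (2 * M))) as [d1 [Hd1 H1]].
{ apply Rdiv_lt_0_compat; lra. }
destruct (proj1 (continuous_eps (V := R_CompleteNormedModule) phi t) Hphi d1 Hd1) as [d2 [Hd2 H2]].
destruct (proj1 (continuous_eps g t) Hg (eps / (2 * M))) as [d3 [Hd3 H3]].
{ apply Rdiv_lt_0_compat; lra. }
exists (Rmin d0 (Rmin d2 d3)). split; [repeat apply Rmin_glb_lt; easy|].
intros s Hs.
assert (Hs0 : Rabs (s - t) < d0) by (eapply Rlt_le_trans; [exact Hs|apply Rmin_l]).
assert (Hs2 : Rabs (s - t) < d2).
{ eapply Rlt_le_trans; [exact Hs|]. eapply Rle_trans; [apply Rmin_r|apply Rmin_l]. }
assert (Hs3 : Rabs (s - t) < d3).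
{ eapply Rlt_le_trans; [exact Hs|]. eapply Rle_trans; [apply Rmin_r|apply Rmin_r]. }
specialize (Hpos s Hs0). specialize (H2 s Hs2). specialize (H3 s Hs3).
assert (H4 : norm (minus (T (Rabs (phi s - phi t)) (g t)) (g t)) < eps / (2 * M)).
{ apply H1. split; [apply Rabs_pos|exact H2]. }
apply Rle_lt_trans with (1 := norm_minus_triangle _ (T (phi s) (g t)) _).
assert (B1 : norm (minus (T (phi s) (g s)) (T (phi s) (g t))) <= M * norm (minus (g s) (g t))).
{ rewrite <- lin_minus by (now apply sg_linear). now apply sg_norm. }
assert (B2 := sg_diff (phi t) (phi s) (g t) Ht Hpos).
apply Rle_lt_trans with (1 := Rplus_le_compat _ _ _ _ B1 B2).
replace eps with (M * (eps / (2 * M)) + M * (eps / (2 * M))) by (field; lra).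
apply Rplus_lt_compat; apply Rmult_lt_compat_l; lra.
Qed.

Lemma continuous_Rmax0 t : continuous (fun s => Rmax 0 s) t.
Proof.
apply (continuous_eps (V := R_CompleteNormedModule)). intros eps He. exists eps. split; [exact He|].
intros s Hs. change (Rabs (Rmax 0 s - Rmax 0 t) < eps).
apply Rle_lt_trans with (2 := Hs). unfold Rmax.
destruct (Rle_dec 0 s), (Rle_dec 0 t); unfold Rabs; repeat destruct (Rcase_abs _); lra.
Qed.

(** Freezing the time at 0 on the negative axis gives an integrand continuous on the whole line, so
    integrals with endpoint 0 exist without a one-sided argument. *)
Lemma continuous_sg_max (g : R -> X) t : continuous g t ->
  continuous (fun s => T (Rmax 0 s) (g s)) t.
Proof.
intros Hg. apply continuous_sg with 1; [lra| |apply continuous_Rmax0|exact Hg].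
intros; apply Rmax_l.
Qed.

Lemma continuous_sg_pos (phi : R -> R) (g : R -> X) (t : R) :
  0 < phi t -> continuous phi t -> continuous g t -> continuous (fun s => T (phi s) (g s)) t.
Proof.
intros Ht Hphi Hg.
destruct (proj1 (continuous_eps (V := R_CompleteNormedModule) phi t) Hphi (phi t) Ht) as [d [Hd H]].
apply continuous_sg with d; try easy. intros s Hs. specialize (H s Hs).
change (Rabs (phi s - phi t) < phi t) in H. apply Rabs_def2 in H. lra.
Qed.

(** [Gamma a] times [A^{-a}]. *)
Definition Jint (a : R) (x : X) : X :=
  RInt_gen (fun t => scal (Rpower t (a - 1)) (T t x)) (at_right 0) (Rbar_locally p_infty).

(** Near 0 the semigroup is bounded by [M]. At infinity [t^(a-1) = t^(2a) t^(-a-1)], and the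
    exponential decay absorbs [t^(2a)]. The factor [K] does not depend on [x], which later makes
    [Jint a] a bounded operator. *)
Lemma Jint_dominated a : 0 < a -> exists K, 0 < K /\ forall x,
  continuous_pos (fun t => scal (Rpower t (a - 1)) (T t x)) /\
  dominated (K * norm x) a (fun t => scal (Rpower t (a - 1)) (T t x)).
Proof.
intros Ha. destruct (Rpower_exp_bound (2 * a) nu) as [K [HK HK']]; [lra|lra|].
exists (M * Rmax 1 K). split.
{ apply Rmult_lt_0_compat; [lra|]. apply Rlt_le_trans with (2 := Rmax_l _ _). lra. }
intros x. split.
- intros t Ht. apply (continuous_scal (V := X)); [now apply continuous_Rpower|].
  apply continuous_sg_pos; [exact Ht|apply continuous_id|apply continuous_const].
- intros t Ht. rewrite norm_scal_eq, Rabs_pos_eq by (left; apply Rpower_pos).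
  assert (B := Hstable t ltac:(lra) x). assert (Hx := norm_pos x).
  split.
  + apply Rle_trans with (Rpower t (a - 1) * (M * norm x)).
    { apply Rmult_le_compat_l; [left; apply Rpower_pos|]. apply sg_norm; lra. }
    rewrite (Rmult_comm (Rpower _ _)). apply Rmult_le_compat_r; [left; apply Rpower_pos|].
    apply Rmult_le_compat_r; [easy|]. rewrite <- (Rmult_1_r M) at 1.
    apply Rmult_le_compat_l; [lra|apply Rmax_l].
  + replace (a - 1) with (2 * a + (- a - 1)) by ring. rewrite Rpower_plus.
    apply Rle_trans with (Rpower t (2 * a) * Rpower t (- a - 1) * (M * exp (- nu * t) * norm x)).
    { apply Rmult_le_compat_l; [|exact B]. left. apply Rmult_lt_0_compat; apply Rpower_pos. }
    replace (Rpower t (2 * a) * Rpower t (- a - 1) * (M * exp (- nu * t) * norm x))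
      with (M * (Rpower t (2 * a) * exp (- nu * t)) * norm x * Rpower t (- a - 1)) by ring.
    apply Rmult_le_compat_r; [left; apply Rpower_pos|].
    apply Rmult_le_compat_r; [easy|]. apply Rmult_le_compat_l; [lra|].
    apply Rle_trans with (2 := Rmax_r _ _). now apply HK'.
Qed.

Lemma is_iint_Jint a x : 0 < a -> is_iint (fun t => scal (Rpower t (a - 1)) (T t x)) (Jint a x).
Proof.
intros Ha. destruct (Jint_dominated a Ha) as [K [HK H]]. destruct (H x) as [Hc Hd].
destruct (ex_iint_dominated _ _ a Ha (Rmult_le_pos K (norm x) ltac:(lra) (norm_pos x)) Hc Hd) as [l Hl].
unfold Jint. now rewrite (iint_unique _ l Hl).
Qed.

Lemma Jint_eq a x l : is_iint (fun t => scal (Rpower t (a - 1)) (T t x)) l -> Jint a x = l.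
Proof. apply iint_unique. Qed.

Lemma Jint_linear a : 0 < a -> is_linear (Jint a).
Proof.
intros Ha. destruct (Jint_dominated a Ha) as [K [HK H]].
apply (lin_intro _ (2 * K / a)).
- intros x y. apply Jint_eq.
  apply is_iint_ext with (2 := is_iint_plus _ _ _ _ (is_iint_Jint a x Ha) (is_iint_Jint a y Ha)).
  intros t Ht. rewrite lin_plus by (apply sg_linear; lra). vec X.
- intros k x. apply Jint_eq.
  apply is_iint_ext with (2 := is_iint_scal _ k _ (is_iint_Jint a x Ha)).
  intros t Ht. rewrite (lin_scal (T t)) by (apply sg_linear; lra). vec X.
- intros x. destruct (H x) as [Hc Hd].
  replace (2 * K / a * norm x) with (2 * (K * norm x) / a) by (field; lra).
  apply (norm_iint_dominated _ _ a _ Ha (Rmult_le_pos K (norm x) ltac:(lra) (norm_pos x)) Hc Hd).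
  now apply is_iint_Jint.
Qed.

Lemma Jint_commute a (B : X -> X) : 0 < a -> is_linear B ->
  (forall t x, 0 < t -> B (T t x) = T t (B x)) -> forall x, Jint a (B x) = B (Jint a x).
Proof.
intros Ha HB H x. apply Jint_eq.
apply is_iint_ext with (2 := is_iint_linear_map B HB _ _ (is_iint_Jint a x Ha)).
intros t Ht. rewrite (lin_scal B HB). now rewrite H.
Qed.

Lemma Jint_sg a t x : 0 < a -> 0 <= t -> Jint a (T t x) = T t (Jint a x).
Proof.
intros Ha Ht. apply Jint_commute; [easy|now apply sg_linear|].
intros s y Hs. apply sg_comm; lra.
Qed.

Lemma is_RInt_sg x a b :
  is_RInt (fun s => T (Rmax 0 s) x) a b (RInt (fun s => T (Rmax 0 s) x) a b).
Proof.
apply (RInt_correct (fun s => T (Rmax 0 s) x)). apply ex_RInt_continuous.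
intros t _. apply continuous_sg_max, continuous_const.
Qed.

Lemma RInt_sg_Chasles x a b c :
  plus (RInt (fun s => T (Rmax 0 s) x) a b) (RInt (fun s => T (Rmax 0 s) x) b c)
  = RInt (fun s => T (Rmax 0 s) x) a c.
Proof.
apply (RInt_Chasles (fun s => T (Rmax 0 s) x)); eexists; apply is_RInt_sg.
Qed.

Lemma RInt_sg_shift h x a b : 0 <= h -> 0 <= a -> 0 <= b ->
  T h (RInt (fun s => T (Rmax 0 s) x) a b) = RInt (fun s => T (Rmax 0 s) x) (a + h) (b + h).
Proof.
intros Hh Ha Hb. symmetry. apply is_RInt_unique.
assert (H := is_RInt_linear_map (T h) (sg_linear h Hh) _ _ _ _ (is_RInt_sg x a b)).
replace a with (1 * (a + h) + - h) in H at 1 by ring.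
replace b with (1 * (b + h) + - h) in H at 1 by ring.
apply is_RInt_comp_lin in H.
eapply is_RInt_ext; [|exact H]. intros s [Hs _].
assert (0 < s - h).
{ apply Rle_lt_trans with (Rmin (a + h) (b + h) - h); [|lra].
  assert (h <= Rmin (a + h) (b + h)) by (apply Rmin_glb; lra). lra. }
simpl. replace (1 * s + - h) with (s - h) by ring.
rewrite !Rmax_right by lra. rewrite <- sg_add by lra.
replace (h + (s - h)) with s by ring. exact (scal_one (T s x)).
Qed.

Lemma is_iint_Jint1 x : is_iint (fun t => T t x) (Jint 1 x).
Proof.
apply is_iint_ext with (2 := is_iint_Jint 1 x Rlt_0_1). intros t Ht.
rewrite Rminus_diag, Rpower_O by easy. exact (scal_one (T t x)).
Qed.

(** For exponent 1 there is no singularity at 0: the piece over [[0, a]] is at most [a M |x|], so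
    the improper integral may start at 0 itself. *)
Lemma Jint1_lim x eps : 0 < eps -> exists N0, 0 <= N0 /\ forall N, N0 <= N ->
  norm (minus (RInt (fun s => T (Rmax 0 s) x) 0 N) (Jint 1 x)) < eps.
Proof.
intros He.
destruct (proj1 (is_iint_eps _ _) (is_iint_Jint1 x) (eps / 2)) as [d [Hd H]]; [lra|].
assert (Hx := norm_pos x).
(* The second term makes [a * (M * norm x) <= eps / 2]; the added 1 keeps the quotient defined when
   [x] is zero. *)
pose (a := Rmin (d / 2) (eps / (2 * (M * norm x + 1)))).
assert (Hden : 0 < M * norm x + 1) by nra.
assert (Ha : 0 < a) by (apply Rmin_glb_lt; [lra|]; apply Rdiv_lt_0_compat; lra).
assert (Had : a < d) by (unfold a; generalize (Rmin_l (d / 2) (eps / (2 * (M * norm x + 1)))); lra).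
exists (/ d + 1). assert (0 < / d) by now apply Rinv_0_lt_compat.
split; [lra|]. intros N HN.
destruct (H a N) as [y [Hy Hn]]; [lra|lra|].
assert (Hy' : RInt (fun s => T (Rmax 0 s) x) a N = y).
{ apply is_RInt_unique. apply is_RInt_ext with (fun t => T t x); [|exact Hy].
  intros s [Hs _]. rewrite Rmax_right; [easy|].
  apply Rle_trans with (Rmin a N); [apply Rmin_glb; lra|lra]. }
rewrite <- (RInt_sg_Chasles x 0 a N), Hy'.
replace (minus (plus (RInt (fun s => T (Rmax 0 s) x) 0 a) y) (Jint 1 x))
  with (plus (RInt (fun s => T (Rmax 0 s) x) 0 a) (minus y (Jint 1 x))) by vec X.
apply Rle_lt_trans with (1 := norm_plus_le _ _).
assert (B : norm (RInt (fun s => T (Rmax 0 s) x) 0 a) <= Rabs (a - 0) * (M * norm x)).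
{ apply (norm_RInt_le_abs (fun s => T (Rmax 0 s) x) 0 a); [|apply is_RInt_sg].
  intros s _. apply sg_norm, Rmax_l. }
rewrite Rminus_0_r, Rabs_pos_eq in B by lra.
assert (B' : a * (M * norm x) <= eps / 2).
{ apply Rle_trans with (eps / (2 * (M * norm x + 1)) * (M * norm x + 1)).
  - apply Rmult_le_compat; [lra|nra|apply Rmin_r|lra].
  - right. field. lra. }
lra.
Qed.

(** Applying [T h] shifts the orbit integral over [[0, oo)] to [[h, oo)], so the difference is the
    piece over [[0, h]]. This is the integrated form of [d/dt T(t) A^(-1) x = - T(t) x], the source
    of all smoothness used below. *)
Lemma Jint1_shift h x : 0 <= h ->
  minus (Jint 1 x) (T h (Jint 1 x)) = RInt (fun s => T (Rmax 0 s) x) 0 h.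
Proof.
intros Hh. apply eq_of_norm_eps. intros eps He.
destruct (Jint1_lim x (eps / (2 * M))) as [N0 [HN0 H]]; [apply Rdiv_lt_0_compat; lra|].
assert (H1 := H N0 (Rle_refl _)). assert (H2 := H (N0 + h) ltac:(lra)).
set (I := fun b => RInt (fun s => T (Rmax 0 s) x) 0 b) in *. fold (I N0) in H1.
fold (I (N0 + h)) in H2. fold (I h).
assert (E : T h (I N0) = minus (I (N0 + h)) (I h)).
{ unfold I. rewrite RInt_sg_shift by lra. rewrite <- (RInt_sg_Chasles x 0 h (N0 + h)).
  rewrite Rplus_0_l. vec X. }
replace (minus (minus (Jint 1 x) (T h (Jint 1 x))) (I h))
  with (minus (T h (minus (I N0) (Jint 1 x))) (minus (I (N0 + h)) (Jint 1 x))).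
2:{ rewrite (lin_minus (T h)) by (now apply sg_linear). rewrite E. vec X. }
apply Rle_lt_trans with (1 := norm_minus_le _ _).
apply Rle_lt_trans with (M * norm (minus (I N0) (Jint 1 x)) + norm (minus (I (N0 + h)) (Jint 1 x))).
{ apply Rplus_le_compat_r. now apply sg_norm. }
assert (Hq : 0 < eps / (2 * M)) by (apply Rdiv_lt_0_compat; lra).
replace eps with (M * (eps / (2 * M)) + M * (eps / (2 * M))) by (field; lra).
apply Rplus_lt_le_compat; [apply Rmult_lt_compat_l; lra|]. nra.
Qed.

Lemma mean_sg_lim x eps : 0 < eps -> exists d, 0 < d /\ forall h, 0 < h < d ->
  norm (minus (scal (/ h) (RInt (fun s => T (Rmax 0 s) x) 0 h) : X) x) < eps.
Proof.
intros He. destruct (sg_near_zero x (eps / 2)) as [d [Hd H]]; [lra|].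
exists d. split; [exact Hd|]. intros h Hh.
replace (minus (scal (/ h) (RInt (fun s => T (Rmax 0 s) x) 0 h) : X) x)
  with (scal (/ h) (minus (RInt (fun s => T (Rmax 0 s) x) 0 h) (scal (h - 0) x))) by (vec X; field; lra).
rewrite norm_scal_eq, Rabs_pos_eq by (left; apply Rinv_0_lt_compat; lra).
apply Rle_lt_trans with (/ h * (Rabs (h - 0) * (eps / 2))).
- apply Rmult_le_compat_l; [left; apply Rinv_0_lt_compat; lra|].
  apply (norm_RInt_le_abs (fun s => minus (T (Rmax 0 s) x) x) 0 h).
  + intros s. rewrite Rmin_left, Rmax_right by lra. intros Hs.
    rewrite Rmax_right by lra. destruct (Req_dec s h) as [->|Hn]; left; apply H; lra.
  + apply (is_RInt_minus (fun s => T (Rmax 0 s) x) (fun _ => x)); [apply is_RInt_sg|].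
    apply (is_RInt_const 0 h x).
- rewrite Rminus_0_r, Rabs_pos_eq by lra. rewrite <- Rmult_assoc, Rinv_l by lra. lra.
Qed.

Lemma Jint1_inj x : Jint 1 x = zero -> x = zero.
Proof.
intros H. apply eq_of_norm_eps. intros eps He.
destruct (mean_sg_lim x eps He) as [d [Hd Hm]]. specialize (Hm (d / 2) ltac:(lra)).
rewrite <- Jint1_shift, H, (lin_zero (T (d / 2))) in Hm by (try apply sg_linear; lra).
rewrite norm_minus_sym in Hm.
apply Rle_lt_trans with (2 := Hm). apply Req_le. apply (f_equal norm). vec X.
Qed.

(** The averages of the orbit approximate [x], and [Jint1_shift] exhibits each of them as the image
    of a difference quotient. *)
Lemma Jint1_dense x eps : 0 < eps -> exists y, norm (minus (Jint 1 y) x) < eps.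
Proof.
intros He. destruct (mean_sg_lim x eps He) as [d [Hd Hm]]. specialize (Hm (d / 2) ltac:(lra)).
exists (scal (/ (d / 2)) (minus x (T (d / 2) x))).
assert (HJ := Jint_linear 1 Rlt_0_1).
rewrite (lin_scal _ HJ), (lin_minus _ HJ), Jint_sg, Jint1_shift by lra. exact Hm.
Qed.

Lemma sg_Jint1_diff r s x : 0 <= r -> 0 <= s ->
  minus (T r (Jint 1 x)) (T s (Jint 1 x)) = RInt (fun s => T (Rmax 0 s) x) r s.
Proof.
intros Hr Hs.
assert (Er := Jint1_shift r x Hr). assert (Es := Jint1_shift s x Hs).
rewrite <- (RInt_sg_Chasles x 0 r s), <- Er in Es.
transitivity (minus (minus (Jint 1 x) (T s (Jint 1 x))) (minus (Jint 1 x) (T r (Jint 1 x))));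
  [vec X|rewrite Es; vec X].
Qed.

Lemma sg_Jint1_lipschitz r0 r s x : 0 <= r0 -> r0 <= r -> r0 <= s ->
  norm (minus (T r (Jint 1 x)) (T s (Jint 1 x))) <= Rabs (s - r) * (M * exp (- nu * r0) * norm x).
Proof.
intros H0 Hr Hs. rewrite sg_Jint1_diff by lra.
apply (norm_RInt_le_abs (fun s => T (Rmax 0 s) x) r s); [|apply is_RInt_sg].
intros y [Hy _]. assert (r0 <= Rmin r s) by now apply Rmin_glb.
rewrite Rmax_right by lra. apply sg_norm_mono; lra.
Qed.

(** The derivative of the orbit of [A^(-2) x] is minus the orbit of [A^(-1) x], which is Lipschitz,
    so the remainder is quadratic. The factor [e^(-nu r0)] is kept because the remainder will itself
    be integrated over times running to infinity. *)
Lemma sg_Jint1_taylor r0 r s x : 0 <= r0 -> r0 <= r -> r0 <= s ->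
  norm (plus (minus (T s (Jint 1 (Jint 1 x))) (T r (Jint 1 (Jint 1 x))))
             (scal (s - r) (T r (Jint 1 x))))
    <= Rabs (s - r) * (Rabs (s - r) * (M * exp (- nu * r0) * norm x)).
Proof.
intros H0 Hr Hs.
replace (plus (minus (T s (Jint 1 (Jint 1 x))) (T r (Jint 1 (Jint 1 x))))
             (scal (s - r) (T r (Jint 1 x))))
  with (opp (minus (RInt (fun s => T (Rmax 0 s) (Jint 1 x)) r s) (scal (s - r) (T r (Jint 1 x))))).
2:{ rewrite <- sg_Jint1_diff by lra. vec X. }
rewrite norm_opp_eq.
apply (norm_RInt_le_abs (fun u => minus (T (Rmax 0 u) (Jint 1 x)) (T r (Jint 1 x))) r s).
- intros u [Hu1 Hu2]. assert (r0 <= Rmin r s) by now apply Rmin_glb.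
  rewrite Rmax_right by lra.
  apply Rle_trans with (1 := sg_Jint1_lipschitz r0 u r x H0 ltac:(lra) Hr).
  apply Rmult_le_compat_r.
  { apply Rmult_le_pos; [apply Rmult_le_pos; [lra|left; apply exp_pos]|apply norm_pos]. }
  revert Hu1 Hu2. unfold Rmin, Rmax, Rabs.
  destruct (Rle_dec r s), (Rcase_abs (r - u)), (Rcase_abs (s - r)); lra.
- apply (is_RInt_minus (fun s => T (Rmax 0 s) (Jint 1 x)) (fun _ => T r (Jint 1 x))); [apply is_RInt_sg|].
  apply (is_RInt_const r s (T r (Jint 1 x))).
Qed.

End Semigroup.

(** * The product formula for fractional powers *)

Lemma exp_opp_le_inv (y : R) : 0 < y -> exp (- y) <= / y.
Proof.
intros Hy. rewrite exp_Ropp. apply Rinv_le_contravar; [easy|].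
generalize (exp_ineq1_le y). lra.
Qed.

Lemma Rpower_le_Rpower_1p (s c d : R) : 0 < s -> 0 <= c <= d -> Rpower s c <= Rpower (1 + s) d.
Proof.
intros Hs Hc. apply Rle_trans with (Rpower (1 + s) c).
- apply Rle_Rpower_l; lra.
- apply Rle_Rpower; lra.
Qed.

(** [beta_kernel b c] is integrable on [(0, oo)] when [0 < b] and [b + c < 1]; for
    [c = 0] its integral is the Beta function at [(b, 1 - b)]. *)
Definition beta_kernel (b c s : R) : R := Rpower s (b - 1) * Rpower (1 + s) (c - 1).

Lemma beta_kernel_pos b c s : 0 < beta_kernel b c s.
Proof. apply Rmult_lt_0_compat; apply Rpower_pos. Qed.

Lemma continuous_beta_kernel b c s : 0 < s -> continuous (beta_kernel b c) s.
Proof.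
intros Hs. apply (continuous_scal (V := R_NormedModule) (fun s => Rpower s (b - 1))
  (fun s => Rpower (1 + s) (c - 1))); [now apply continuous_Rpower|].
apply (continuous_comp (fun s => 1 + s) (fun y => Rpower y (c - 1))).
- apply (continuous_plus (V := R_NormedModule)); [apply continuous_const|apply continuous_id].
- apply continuous_Rpower. lra.
Qed.

(** Write [s^(b-1) = s^(e-1) s^(b-e)]; as long as [0 <= b - e <= 1 - c], the factor [s^(b-e)] is
    absorbed by [(1+s)^(1-c)]. The two bounds are the cases [e = a] and [e = - a]. *)
Lemma beta_kernel_bound b c a s : 0 < a -> a <= b -> a + b <= 1 - c -> 0 < s ->
  beta_kernel b c s <= Rpower s (a - 1) /\ beta_kernel b c s <= Rpower s (- a - 1).
Proof.
intros Ha Hb Hc Hs. unfold beta_kernel.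
assert (H : forall e, 0 <= b - e <= 1 - c ->
  Rpower s (b - 1) * Rpower (1 + s) (c - 1) <= Rpower s (e - 1)).
{ intros e He. replace (b - 1) with ((e - 1) + (b - e)) by ring. rewrite Rpower_plus.
  rewrite Rmult_assoc. rewrite <- (Rmult_1_r (Rpower s (e - 1))) at 2.
  apply Rmult_le_compat_l; [left; apply Rpower_pos|].
  replace (c - 1) with (- (1 - c)) by ring. rewrite Rpower_Ropp.
  apply Rmult_le_reg_r with (Rpower (1 + s) (1 - c)); [apply Rpower_pos|].
  rewrite Rmult_assoc, Rinv_l by (apply Rgt_not_eq, Rpower_pos).
  rewrite Rmult_1_r, Rmult_1_l. now apply Rpower_le_Rpower_1p. }
split; apply H; lra.
Qed.

Definition beta_int (b : R) : R :=
  RInt_gen (beta_kernel b 0) (at_right 0) (Rbar_locally p_infty).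

Lemma is_iint_beta b : 0 < b < 1 -> is_RInt_gen (V := R_CompleteNormedModule) (beta_kernel b 0) (at_right 0) (Rbar_locally p_infty) (beta_int b).
Proof.
(* The margin of integrability is [b] at 0 and [1 - b] at infinity; [dominated] uses one exponent
   for both ends. *)
intros Hb. pose (a := Rmin b (1 - b)).
assert (Ha : 0 < a) by (apply Rmin_glb_lt; lra).
destruct (ex_iint_dominated (V := R_CompleteNormedModule) (beta_kernel b 0) 1 a Ha Rle_0_1) as [l Hl].
- intros t Ht. now apply continuous_beta_kernel.
- intros t Ht. rewrite !Rmult_1_l.
  change (norm (beta_kernel b 0 t)) with (Rabs (beta_kernel b 0 t)).
  rewrite Rabs_pos_eq by (left; apply beta_kernel_pos).
  apply beta_kernel_bound; try easy; unfold a.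
  + apply Rmin_l.
  + generalize (Rmin_r b (1 - b)). lra.
- unfold beta_int. now rewrite (iint_unique (V := R_CompleteNormedModule) _ l Hl).
Qed.

Section Product.

Context {X : CompleteNormedModule R_AbsRing} (T : R -> X -> X).
Context (HT : C0_semigroup T) (M nu : R) (HM : 1 <= M) (Hnu : 0 < nu).
Context (Hstable : forall t, 0 <= t -> forall x, norm (T t x) <= M * exp (- nu * t) * norm x).
Context (al be : R) (Hal : 0 < al) (Hbe : 0 < be) (Hab : al + be = 1).

(** [Psi x t] is an antiderivative of [- t^(al - 1) T(t) (Jint be x)] when [x] is smooth:
    after the substitution [s = t sigma] in [Jint be x] the variable [t] only
    occurs in the semigroup. *)
Definition Psi (x : X) (t : R) : X :=
  RInt_gen (fun s => scal (beta_kernel be 0 s) (T (t * (1 + s)) (Jint T 1 x)))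
    (at_right 0) (Rbar_locally p_infty).

Lemma continuous_scaled_sg (x : X) (w : R -> R) t : 0 < t ->
  (forall s, 0 < s -> continuous w s) ->
  continuous_pos (fun s => scal (w s) (T (t * (1 + s)) x)).
Proof.
intros Ht Hw s Hs. apply (continuous_scal (V := X)); [now apply Hw|].
apply (continuous_sg_pos T HT M nu); try easy.
- nra.
- apply (continuous_scal_r (V := R_NormedModule) t (fun s => 1 + s)).
  apply (continuous_plus (V := R_NormedModule)); [apply continuous_const|apply continuous_id].
- apply continuous_const.
Qed.

(** Since [t * (1 + s) >= t], the decay [e^(-nu t)] comes out of the integral; it is what makes
    [Psi] vanish at infinity. *)
Lemma Psi_spec x t : 0 < t ->
  is_iint (fun s => scal (beta_kernel be 0 s) (T (t * (1 + s)) (Jint T 1 x))) (Psi x t) /\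
  norm (Psi x t) <= 2 * (M * exp (- nu * t) * norm (Jint T 1 x)) / Rmin al be.
Proof.
intros Ht. set (z := Jint T 1 x).
assert (Ha : 0 < Rmin al be) by (now apply Rmin_glb_lt).
assert (H1 := Rmin_l al be). assert (H2 := Rmin_r al be).
assert (HK : 0 <= M * exp (- nu * t) * norm z).
{ apply Rmult_le_pos; [apply Rmult_le_pos; [lra|left; apply exp_pos]|apply norm_pos]. }
assert (Hc : continuous_pos (fun s => scal (beta_kernel be 0 s) (T (t * (1 + s)) z))).
{ apply continuous_scaled_sg; [easy|]. intros. now apply continuous_beta_kernel. }
assert (Hd : dominated (M * exp (- nu * t) * norm z) (Rmin al be)
   (fun s => scal (beta_kernel be 0 s) (T (t * (1 + s)) z))).
{ intros s Hs. rewrite norm_scal_eq, Rabs_pos_eq by (left; apply beta_kernel_pos).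
  assert (B := sg_norm_mono T M nu HM Hnu Hstable t (t * (1 + s)) z ltac:(nra)).
  destruct (beta_kernel_bound be 0 (Rmin al be) s) as [k1 k2]; [lra|lra|lra|easy|].
  assert (k0 := beta_kernel_pos be 0 s).
  rewrite !(Rmult_comm _ (Rpower s _)).
  split; apply Rmult_le_compat; try easy; try apply norm_pos; lra. }
destruct (ex_iint_dominated _ _ _ Ha HK Hc Hd) as [l Hl].
assert (E : Psi x t = l) by (exact (iint_unique _ l Hl)).
rewrite E. split; [exact Hl|]. exact (norm_iint_dominated _ _ _ l Ha HK Hc Hd Hl).
Qed.

(** Interpolates between the Lipschitz bound for [r <= 1] and boundedness for [r >= 1]. The
    Lipschitz exponent would be too large for the limit of [Psi] at 0: there [r = t * (1 + s)] is
    integrated against a kernel of order [s^(be-2)] at infinity, so [g] must stay below [al]. *)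
Lemma sg_holder x g : 0 < g <= 1 -> exists C, 0 <= C /\
  forall r, 0 < r -> norm (minus (T r (Jint T 1 x)) (Jint T 1 x)) <= C * Rpower r g.
Proof.
intros Hg. set (z := Jint T 1 x).
assert (Hz := norm_pos z). assert (Hx := norm_pos x).
exists ((M + 1) * norm z + M * norm x). split; [nra|].
intros r Hr. destruct (Rle_or_lt r 1) as [h|h].
- assert (B := sg_Jint1_lipschitz T HT M nu HM Hnu Hstable 0 r 0 x (Rle_refl _) ltac:(lra) (Rle_refl _)).
  rewrite (sg_zero T HT), Rminus_0_l, Rabs_Ropp, Rabs_pos_eq, Rmult_0_r, exp_0, Rmult_1_r in B by lra.
  apply Rle_trans with (1 := B).
  assert (r <= Rpower r g).
  { rewrite <- (Rpower_1 r Hr) at 1. unfold Rpower. apply exp_le_compat.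
    assert (ln r <= 0) by (rewrite <- ln_1; destruct h as [h|h]; [left; apply ln_increasing; lra|rewrite h; lra]).
    nra. }
  assert (0 <= M * norm x) by nra.
  apply Rle_trans with (M * norm x * Rpower r g); [rewrite Rmult_comm; now apply Rmult_le_compat_l|].
  apply Rmult_le_compat_r; [left; apply Rpower_pos|nra].
- apply Rle_trans with (1 := norm_minus_le _ _).
  assert (B := sg_norm T M nu HM Hnu Hstable r z ltac:(lra)).
  assert (1 <= Rpower r g).
  { rewrite <- (Rpower_O r) by lra. apply Rle_Rpower; lra. }
  assert (0 <= M * norm x) by nra.
  apply Rle_trans with (((M + 1) * norm z + M * norm x) * 1); [fold z; lra|].
  apply Rmult_le_compat_l; [nra|easy].
Qed.

(** The difference is one integral, whose integrand is at most [C t^(al/2)] times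
    [beta_kernel be (al / 2)] by the Hoelder bound. *)
Lemma Psi_zero x : exists C g, 0 <= C /\ 0 < g /\
  forall t, 0 < t -> norm (minus (Psi x t) (scal (beta_int be) (Jint T 1 x))) <= C * Rpower t g.
Proof.
destruct (sg_holder x (al / 2)) as [C [HC H]]; [lra|].
set (z := Jint T 1 x) in *.
(* The kernel with exponents [be] and [al / 2] has margin [be] at 0 and [1 - be - al / 2 = al / 2]
   at infinity. *)
pose (a := Rmin be (al / 2)).
assert (Ha : 0 < a) by (apply Rmin_glb_lt; lra).
assert (H1 := Rmin_l be (al / 2)). assert (H2 := Rmin_r be (al / 2)). fold a in H1, H2.
exists (2 * C / a), (al / 2). split; [apply Rdiv_le_0_compat; lra|]. split; [lra|].
intros t Ht.
assert (HI : is_iint (fun s => minus (scal (beta_kernel be 0 s) (T (t * (1 + s)) z)) (scal (beta_kernel be 0 s) z))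
   (minus (Psi x t) (scal (beta_int be) z))).
{ apply is_iint_minus; [now apply Psi_spec|].
  apply (is_iint_linear_map (U := R_CompleteNormedModule) (fun k : R => scal k z)).
  - apply (is_linear_scal_l z).
  - apply is_iint_beta. lra. }
replace (2 * C / a * Rpower t (al / 2)) with (2 * (C * Rpower t (al / 2)) / a) by (field; lra).
apply (norm_iint_dominated _ _ a _ Ha) with (4 := HI).
- apply Rmult_le_pos; [easy|left; apply Rpower_pos].
- intros s Hs. apply (continuous_minus (V := X)).
  + apply (continuous_scaled_sg z (beta_kernel be 0) t); [easy| |easy].
    intros. now apply continuous_beta_kernel.
  + apply (continuous_scal_l (V := X)). now apply continuous_beta_kernel.
- intros s Hs.
  assert (B : norm (minus (scal (beta_kernel be 0 s) (T (t * (1 + s)) z)) (scal (beta_kernel be 0 s) z))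
     <= C * Rpower t (al / 2) * beta_kernel be (al / 2) s).
  { replace (minus (scal (beta_kernel be 0 s) (T (t * (1 + s)) z)) (scal (beta_kernel be 0 s) z))
      with (scal (beta_kernel be 0 s) (minus (T (t * (1 + s)) z) z)) by vec X.
    rewrite norm_scal_eq, Rabs_pos_eq by (left; apply beta_kernel_pos).
    apply Rle_trans with (beta_kernel be 0 s * (C * Rpower (t * (1 + s)) (al / 2))).
    - apply Rmult_le_compat_l; [left; apply beta_kernel_pos|]. apply H. nra.
    - right. unfold beta_kernel. rewrite <- Rpower_mult_distr by lra.
      replace (al / 2 - 1) with (al / 2 + (0 - 1)) by ring. rewrite Rpower_plus. ring. }
  destruct (beta_kernel_bound be (al / 2) a s) as [k1 k2]; [lra|lra|lra|easy|].
  assert (HC' : 0 <= C * Rpower t (al / 2)) by (apply Rmult_le_pos; [easy|left; apply Rpower_pos]).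
  split; apply Rle_trans with (1 := B); now apply Rmult_le_compat_l.
Qed.

(** The substitution [s -> t s] in [Jint be] produces the factor [t^be], which cancels [t^(al-1)]
    because [al + be = 1]. *)
Lemma is_iint_rescaled x t : 0 < t ->
  is_iint (fun s => scal (Rpower s (be - 1)) (T (t * (1 + s)) x))
    (scal (Rpower t (al - 1)) (T t (Jint T be x))).
Proof.
intros Ht. rewrite <- (Jint_sg T HT M nu HM Hnu Hstable be t x) by lra.
assert (H := is_iint_Jint T HT M nu HM Hnu Hstable be (T t x) Hbe).
apply (is_iint_scale _ t _ Ht), (is_iint_scal _ (Rpower t (al - 1))) in H.
revert H. apply is_iint_ext. intros s Hs.
rewrite <- (sg_add T HT) by nra. replace (t * s + t) with (t * (1 + s)) by ring.
vec X. rewrite <- Rpower_mult_distr by easy.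
rewrite <- (Rpower_1 t Ht) at 2.
replace (Rpower t (al - 1) * (Rpower t 1 * (Rpower t (be - 1) * Rpower s (be - 1) * 1)))
  with (Rpower t ((al - 1) + 1 + (be - 1)) * Rpower s (be - 1)) by (rewrite !Rpower_plus; ring).
replace (al - 1 + 1 + (be - 1)) with 0 by lra. rewrite Rpower_O by easy. ring.
Qed.

(** Differentiation under the integral by the Taylor estimate for [T] between [t (1 + s)] and
    [(t + h) (1 + s)]. The increment [h (1 + s)] cancels the factor [1 / (1 + s)] of the kernel,
    leaving the integrand of [is_iint_rescaled]; the remainder is of order [h^2 (1 + s)] times an
    exponential. *)
Lemma Psi_derive x t : 0 < t ->
  is_derive (Psi (Jint T 1 x)) t (opp (scal (Rpower t (al - 1)) (T t (Jint T be (Jint T 1 x))))).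
Proof.
(* For [|h| < t / 2] all times involved are at least [t / 2 * (1 + s)], so the semigroup decays like
   [e^(-mu (1 + s))] uniformly in [h]. *)
intros Ht. pose (mu := nu * (t / 2)).
assert (Hmu : 0 < mu) by (unfold mu; nra).
(* [K1] serves the bound at 0, for the factor [(1 + s)] of the remainder; [K2] serves the bound at
   infinity, where [s^(be-1)] is traded for [s^(-be-1)] at the cost of another [(1 + s)^(2 be)]. *)
destruct (Rpower_exp_bound 1 mu) as [K1 [HK1 B1]]; [lra|easy|].
destruct (Rpower_exp_bound (2 * be + 1) mu) as [K2 [HK2 B2]]; [lra|easy|].
assert (Hx := norm_pos x).
pose (K := M * norm x * Rmax K1 K2).
assert (HK : 0 <= K).
{ apply Rmult_le_pos; [nra|]. apply Rle_trans with (2 := Rmax_l _ _). lra. }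
apply is_derive_eps. intros eps He.
(* The remainder integrates to at most [|h|^2 * 2 K / be]; the second term turns one factor [|h|]
   into [eps], and the added 1 covers [K = 0]. *)
pose (d := Rmin (t / 2) (eps / (2 * K / be + 1))).
assert (Hq : 0 <= 2 * K / be) by (apply Rdiv_le_0_compat; lra).
exists d. split.
{ apply Rmin_glb_lt; [lra|]. apply Rdiv_lt_0_compat; lra. }
intros h Hh.
assert (Hh1 : Rabs h < t / 2) by (apply Rlt_le_trans with (1 := Hh); apply Rmin_l).
assert (Hh2 : Rabs h < eps / (2 * K / be + 1)) by (apply Rlt_le_trans with (1 := Hh); apply Rmin_r).
assert (Hth : t / 2 < t + h) by (apply Rabs_def2 in Hh1; lra).
set (y := Jint T 1 x) in *. set (z := Jint T 1 y).
set (P := scal (Rpower t (al - 1)) (T t (Jint T be y))).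
assert (HI : is_iint (fun s => plus (minus (scal (beta_kernel be 0 s) (T ((t + h) * (1 + s)) z))
                                (scal (beta_kernel be 0 s) (T (t * (1 + s)) z)))
                           (scal h (scal (Rpower s (be - 1)) (T (t * (1 + s)) y))))
               (plus (minus (Psi y (t + h)) (Psi y t)) (scal h P))).
{ apply is_iint_plus.
  - apply is_iint_minus; apply Psi_spec; lra.
  - apply is_iint_scal. now apply is_iint_rescaled. }
replace (minus (minus (Psi y (t + h)) (Psi y t)) (scal h (opp P)))
  with (plus (minus (Psi y (t + h)) (Psi y t)) (scal h P)) by vec X.
assert (Hn : norm (plus (minus (Psi y (t + h)) (Psi y t)) (scal h P))
   <= 2 * (Rabs h * Rabs h * K) / be).
{ apply (norm_iint_dominated _ _ be _ Hbe) with (4 := HI).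
  - apply Rmult_le_pos; [|easy]. apply Rmult_le_pos; apply Rabs_pos.
  - intros s Hs. apply (continuous_plus (V := X)); [apply (continuous_minus (V := X))|].
    + apply (continuous_scaled_sg z (beta_kernel be 0) (t + h)); [lra| |easy].
      intros. now apply continuous_beta_kernel.
    + apply (continuous_scaled_sg z (beta_kernel be 0) t); [lra| |easy].
      intros. now apply continuous_beta_kernel.
    + apply (continuous_scal_r (V := X)).
      apply (continuous_scaled_sg y (fun s => Rpower s (be - 1)) t); [lra| |easy].
      intros. now apply continuous_Rpower.
  - intros s Hs.
    assert (B : norm (plus (minus (scal (beta_kernel be 0 s) (T ((t + h) * (1 + s)) z))
                                (scal (beta_kernel be 0 s) (T (t * (1 + s)) z)))
                           (scal h (scal (Rpower s (be - 1)) (T (t * (1 + s)) y))))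
       <= Rabs h * Rabs h * (M * norm x) * (Rpower s (be - 1) * ((1 + s) * exp (- mu * (1 + s))))).
    { replace (plus (minus (scal (beta_kernel be 0 s) (T ((t + h) * (1 + s)) z))
                                (scal (beta_kernel be 0 s) (T (t * (1 + s)) z)))
                           (scal h (scal (Rpower s (be - 1)) (T (t * (1 + s)) y))))
        with (scal (beta_kernel be 0 s) (plus (minus (T ((t + h) * (1 + s)) z) (T (t * (1 + s)) z))
                (scal ((t + h) * (1 + s) - t * (1 + s)) (T (t * (1 + s)) y)))).
      2:{ vec X. unfold beta_kernel. rewrite Rminus_0_l, Rpower_Ropp, Rpower_1 by lra. field. lra. }
      rewrite norm_scal_eq, Rabs_pos_eq by (left; apply beta_kernel_pos).
      assert (Bt := sg_Jint1_taylor T HT M nu HM Hnu Hstable (t / 2 * (1 + s)) (t * (1 + s))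
                     ((t + h) * (1 + s)) x ltac:(nra) ltac:(nra) ltac:(nra)).
      apply Rle_trans with (1 := Rmult_le_compat_l _ _ _ (Rlt_le _ _ (beta_kernel_pos be 0 s)) Bt).
      replace ((t + h) * (1 + s) - t * (1 + s)) with (h * (1 + s)) by ring.
      rewrite Rabs_mult, (Rabs_pos_eq (1 + s)) by lra.
      replace (- nu * (t / 2 * (1 + s))) with (- mu * (1 + s)) by (unfold mu; ring).
      unfold beta_kernel. rewrite Rminus_0_l, Rpower_Ropp, Rpower_1 by lra.
      right. field. lra. }
    assert (Hhh : 0 <= Rabs h * Rabs h * (M * norm x)).
    { apply Rmult_le_pos; [apply Rmult_le_pos; apply Rabs_pos|nra]. }
    split; apply Rle_trans with (1 := B); unfold K.
    + replace (Rabs h * Rabs h * (M * norm x * Rmax K1 K2) * Rpower s (be - 1))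
        with (Rabs h * Rabs h * (M * norm x) * (Rpower s (be - 1) * Rmax K1 K2)) by ring.
      apply Rmult_le_compat_l; [easy|]. apply Rmult_le_compat_l; [left; apply Rpower_pos|].
      apply Rle_trans with (2 := Rmax_l _ _).
      specialize (B1 (1 + s) ltac:(lra)). now rewrite Rpower_1 in B1 by lra.
    + replace (Rabs h * Rabs h * (M * norm x * Rmax K1 K2) * Rpower s (- be - 1))
        with (Rabs h * Rabs h * (M * norm x) * (Rpower s (- be - 1) * Rmax K1 K2)) by ring.
      apply Rmult_le_compat_l; [easy|].
      replace (be - 1) with ((- be - 1) + 2 * be) by ring. rewrite Rpower_plus, Rmult_assoc.
      apply Rmult_le_compat_l; [left; apply Rpower_pos|].
      apply Rle_trans with (2 := Rmax_r _ _).
      apply Rle_trans with (2 := B2 (1 + s) ltac:(lra)).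
      rewrite Rpower_plus, Rpower_1, <- Rmult_assoc by lra.
      apply Rmult_le_compat_r; [left; apply exp_pos|].
      apply Rmult_le_compat_r; [lra|]. apply Rpower_le_Rpower_1p; lra. }
apply Rle_trans with (1 := Hn).
replace (2 * (Rabs h * Rabs h * K) / be) with (Rabs h * (2 * K / be) * Rabs h) by (field; lra).
apply Rmult_le_compat_r; [apply Rabs_pos|].
apply Rle_trans with (eps / (2 * K / be + 1) * (2 * K / be + 1)).
- apply Rmult_le_compat; [apply Rabs_pos|easy|lra|lra].
- right. field. split; lra.
Qed.

Lemma Jint_mul x : Jint T al (Jint T be x) = scal (beta_int be) (Jint T 1 x).
Proof.
assert (Hsmooth : forall y, Jint T al (Jint T be (Jint T 1 y)) = scal (beta_int be) (Jint T 1 (Jint T 1 y))).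
{ intros x2. set (y := Jint T 1 x2). apply Jint_eq.
  destruct (Psi_zero y) as [C [g [HC [Hg H0]]]].
  set (z := Jint T 1 y) in *.
  apply is_iint_eps. intros eps He.
  assert (Ha : 0 < Rmin al be) by (now apply Rmin_glb_lt).
  pose (e := eps / (2 * (C + 1))).
  assert (Hep : 0 < e) by (apply Rdiv_lt_0_compat; lra).
  (* The bound of [Psi_spec] at [b], with [e^(-nu b) <= 1 / (nu b)] and [1 / b < d], becomes
     [C' * d]. *)
  pose (C' := 2 * (M * norm z) / Rmin al be / nu).
  assert (HC' : 0 <= C').
  { unfold C'. apply Rdiv_le_0_compat; [|easy]. apply Rdiv_le_0_compat; [|easy].
    assert (Hz := norm_pos z). nra. }
  (* The first term brings [Psi y a] within [C * e] of its limit at 0, the second makes [Psi y b] at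
     most [eps / 2]. *)
  pose (d := Rmin (Rpower e (/ g)) (eps / (2 * (C' + 1)))).
  assert (Hd : 0 < d).
  { apply Rmin_glb_lt; [apply Rpower_pos|]. apply Rdiv_lt_0_compat; lra. }
  exists d. split; [exact Hd|]. intros a b Ha' Hb.
  assert (Hdi : 0 < / d) by now apply Rinv_0_lt_compat.
  assert (Hmin : 0 < Rmin a b) by (apply Rmin_glb_lt; lra).
  exists (minus (opp (Psi y b)) (opp (Psi y a))). split.
  - apply (is_RInt_derive (fun t => opp (Psi y t))
      (fun t => scal (Rpower t (al - 1)) (T t (Jint T be y)))).
    + intros t [Ht _].
      replace (scal (Rpower t (al - 1)) (T t (Jint T be y)))
        with (opp (opp (scal (Rpower t (al - 1)) (T t (Jint T be y))))) by vec X.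
      apply (is_derive_opp (V := X)). apply Psi_derive. lra.
    + intros t [Ht _]. apply (continuous_scal (V := X)); [apply continuous_Rpower; lra|].
      apply (continuous_sg_pos T HT M nu HM Hnu Hstable (fun s => s) (fun _ => Jint T be y) t);
        [lra|apply continuous_id|apply continuous_const].
  - replace (minus (minus (opp (Psi y b)) (opp (Psi y a))) (scal (beta_int be) z))
      with (minus (minus (Psi y a) (scal (beta_int be) z)) (Psi y b)) by vec X.
    apply Rle_lt_trans with (1 := norm_minus_le _ _).
    assert (Ba : norm (minus (Psi y a) (scal (beta_int be) z)) <= C * e).
    { apply Rle_trans with (1 := H0 a ltac:(lra)). apply Rmult_le_compat_l; [easy|].
      replace e with (Rpower (Rpower e (/ g)) g) by (rewrite Rpower_mult, Rinv_l, Rpower_1; lra).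
      apply Rle_Rpower_l; [lra|]. split; [lra|].
      apply Rle_trans with d; [lra|apply Rmin_l]. }
    assert (Bb : norm (Psi y b) <= C' * d).
    { destruct (Psi_spec y b ltac:(lra)) as [_ Bb]. fold z in Bb. apply Rle_trans with (1 := Bb).
      replace (C' * d) with (2 * (M * (d / nu) * norm z) / Rmin al be) by (unfold C'; field; lra).
      apply Rmult_le_compat_r; [left; now apply Rinv_0_lt_compat|].
      apply Rmult_le_compat_l; [lra|]. apply Rmult_le_compat_r; [apply norm_pos|].
      apply Rmult_le_compat_l; [lra|].
      replace (- nu * b) with (- (nu * b)) by ring.
      assert (Hnb : 0 < nu * b) by (apply Rmult_lt_0_compat; lra).
      apply Rle_trans with (1 := exp_opp_le_inv (nu * b) Hnb).
      replace (d / nu) with (/ (nu * / d)) by (field; lra).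
      apply Rinv_le_contravar; [nra|]. apply Rmult_le_compat_l; lra. }
    apply Rle_lt_trans with (1 := Rplus_le_compat _ _ _ _ Ba Bb).
    assert (C * e < eps / 2).
    { unfold e. replace (eps / 2) with (eps / (2 * (C + 1)) * (C + 1)) by (field; lra).
      fold e. nra. }
    assert (C' * d <= eps / 2).
    { apply Rle_trans with ((C' + 1) * (eps / (2 * (C' + 1)))); [|right; field; lra].
      apply Rmult_le_compat; [easy|lra|lra|apply Rmin_r]. }
    lra. }
assert (L1 := Jint_linear T HT M nu HM Hnu Hstable 1 Rlt_0_1).
assert (La := Jint_linear T HT M nu HM Hnu Hstable al Hal).
assert (Lb := Jint_linear T HT M nu HM Hnu Hstable be Hbe).
(* The defect of the formula is a bounded operator that vanishes on the range of [Jint T 1], which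
   is dense, hence everywhere. *)
assert (LD : is_linear (fun x => minus (Jint T al (Jint T be x)) (scal (beta_int be) (Jint T 1 x)))).
{ destruct (linear_norm _ L1) as [N1 [HN1 E1]]. destruct (linear_norm _ La) as [Na [HNa Ea]].
  destruct (linear_norm _ Lb) as [Nb [HNb Eb]].
  apply (lin_intro _ (Na * Nb + Rabs (beta_int be) * N1)).
  - intros u v. rewrite (lin_plus _ Lb), (lin_plus _ La), (lin_plus _ L1). vec X.
  - intros k u. rewrite (lin_scal _ Lb), (lin_scal _ La), (lin_scal _ L1). vec X.
  - intros u. apply Rle_trans with (1 := norm_minus_le _ _).
    rewrite norm_scal_eq, Rmult_plus_distr_r, !Rmult_assoc. apply Rplus_le_compat.
    + apply Rle_trans with (1 := Ea _). apply Rmult_le_compat_l; [lra|apply Eb].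
    + apply Rmult_le_compat_l; [apply Rabs_pos|apply E1]. }
destruct (linear_norm _ LD) as [N [HN E]].
apply eq_of_norm_eps. intros eps He.
destruct (Jint1_dense T HT M nu HM Hnu Hstable x (eps / N)) as [y Hy]; [now apply Rdiv_lt_0_compat|].
rewrite norm_minus_sym in Hy. specialize (E (minus x (Jint T 1 y))).
apply Rle_lt_trans with (N * norm (minus x (Jint T 1 y))).
- apply Rle_trans with (2 := E). apply Req_le. apply (f_equal norm).
  rewrite (lin_minus _ Lb), (lin_minus _ La), (lin_minus _ L1), Hsmooth. vec X.
- apply Rlt_le_trans with (N * (eps / N)); [now apply Rmult_lt_compat_l|].
  right. field. lra.
Qed.

End Product.

(** * Fractional powers, the generator and the inverse of I - T(omega) *)

(** [real] sends an infinite supremum to 0, so both infinite values have to be excluded: one by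
    boundedness of [B], the other because the unit ball contains [zero]. *)
Lemma opnorm_le {U : CompleteNormedModule R_AbsRing} (B : U -> U) : is_linear B ->
  forall x, norm (B x) <= real (opnorm B) * norm x.
Proof.
intros HB x. destruct (linear_norm B HB) as [N [HN E]].
unfold opnorm. assert (HL := Lub_Rbar_correct (fun r => exists x : U, norm x <= 1 /\ r = norm (B x))).
destruct (Lub_Rbar _) as [c| |]; destruct HL as [Hub Hleast].
- simpl. destruct (Req_dec (norm x) 0) as [Hx|Hx].
  + rewrite Hx, Rmult_0_r. apply Rle_trans with (1 := E x). rewrite Hx. lra.
  + assert (Hx' : 0 < norm x) by (generalize (norm_pos x); lra).
    assert (H : norm (B (scal (/ norm x) x)) <= c).
    { apply (Hub (norm (B (scal (/ norm x) x)))). eexists. split; [|reflexivity].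
      rewrite norm_scal_eq, Rabs_pos_eq, Rinv_l by (try left; try apply Rinv_0_lt_compat; lra). lra. }
    rewrite (lin_scal B HB), norm_scal_eq, Rabs_pos_eq in H by (left; now apply Rinv_0_lt_compat).
    apply Rmult_le_reg_l with (/ norm x); [now apply Rinv_0_lt_compat|].
    apply Rle_trans with (1 := H). right. field. lra.
- exfalso. apply (Hleast (Finite N)). intros r [y [Hy ->]].
  simpl. apply Rle_trans with (1 := E y). nra.
- exfalso. apply (Hub (norm (B zero))). exists zero. split; [|reflexivity].
  rewrite norm_zero_eq. lra.
Qed.

(** * Gamma values through the scalar semigroup *)

Lemma iint_positive (f : R -> R) (l : R) : (forall t, 0 < t -> continuous f t) ->
  (forall t, 0 < t -> 0 < f t) ->
  is_RInt_gen (V := R_CompleteNormedModule) f (at_right 0) (Rbar_locally p_infty) l -> 0 < l.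
Proof.
intros Hc Hp Hl.
assert (Hex : forall a b, 0 < a -> 0 < b -> ex_RInt f a b).
{ intros a b. apply (ex_RInt_pos (V := R_CompleteNormedModule) f). exact Hc. }
(* A truncated integral within [RInt f 1 2] of [l] is itself at least [RInt f 1 2], since the outer
   pieces are nonnegative; hence [l] is positive. *)
assert (H12 : 0 < RInt f 1 2).
{ apply RInt_gt_0; [lra| |]; intros; [apply Hp|apply Hc]; lra. }
destruct (proj1 (is_iint_eps (V := R_CompleteNormedModule) f l) Hl (RInt f 1 2) H12) as [d [Hd H]].
assert (Hm : 0 < Rmin d 1) by (apply Rmin_glb_lt; lra).
assert (H1 := Rmin_l d 1). assert (H2 := Rmin_r d 1).
assert (Hid : 0 < / d) by now apply Rinv_0_lt_compat.
destruct (H (Rmin d 1 / 2) (/ d + 2)) as [y [Hy Hn]]; [lra|lra|].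
apply is_RInt_unique in Hy.
rewrite <- (RInt_Chasles f _ 1 _), <- (RInt_Chasles f 1 2 _) in Hy by (apply Hex; lra).
assert (B1 : 0 <= RInt f (Rmin d 1 / 2) 1).
{ apply RInt_ge_0; [lra|apply Hex; lra|]. intros; left; apply Hp; lra. }
assert (B2 : 0 <= RInt f 2 (/ d + 2)).
{ apply RInt_ge_0; [lra|apply Hex; lra|]. intros; left; apply Hp; lra. }
change (RInt f (Rmin d 1 / 2) 1 + (RInt f 1 2 + RInt f 2 (/ d + 2)) = y) in Hy.
change (Rabs (y - l) < RInt f 1 2) in Hn. apply Rabs_def2 in Hn. lra.
Qed.

(** The scalar semigroup, whose negative powers are the Gamma integrals. *)
Definition exp_sg (t : R) (x : R_CompleteNormedModule) : R_CompleteNormedModule := exp (- t) * x.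

Lemma exp_sg_C0 : C0_semigroup exp_sg.
Proof.
split; [|split; [|split]].
- intros t Ht. apply (lin_intro (U := R_CompleteNormedModule) (V := R_CompleteNormedModule) _ (exp (- t))).
  + intros x y. apply Rmult_plus_distr_l.
  + intros k x. change (exp (- t) * (k * x) = k * (exp (- t) * x)). ring.
  + intros x. change (Rabs (exp (- t) * x) <= exp (- t) * Rabs x).
    rewrite Rabs_mult, (Rabs_pos_eq (exp (- t))) by (left; apply exp_pos). lra.
- intros x. unfold exp_sg. rewrite Ropp_0, exp_0. apply Rmult_1_l.
- intros s t x _ _. unfold exp_sg. rewrite Ropp_plus_distr, exp_plus. apply Rmult_assoc.
- intros x. apply filterlim_eps; [apply at_right_proper_filter|].
  assert (Hc : continuous (T := R_UniformSpace) (U := R_UniformSpace) (fun t : R => exp (- t) * x) 0).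
  { apply (ex_derive_continuous (V := R_NormedModule)). auto_derive. easy. }
  intros eps He.
  destruct (proj1 (continuous_eps _ _) Hc eps He) as [d [Hd H]].
  apply at_right_eps. exists d. split; [easy|]. intros h Hh.
  specialize (H h). rewrite Rminus_0_r, Rabs_pos_eq, Ropp_0, exp_0, Rmult_1_l in H by lra.
  apply H. lra.
Qed.

Lemma exp_sg_stable t : 0 <= t -> forall x, norm (exp_sg t x) <= 1 * exp (- 1 * t) * norm x.
Proof.
intros _ x. change (Rabs (exp (- t) * x) <= 1 * exp (- 1 * t) * Rabs x).
rewrite Rabs_mult, Rabs_pos_eq by (left; apply exp_pos).
replace (- 1 * t) with (- t) by ring. lra.
Qed.

Lemma Jint_exp_sg a : 0 < a -> Jint exp_sg a 1 = Gamma a.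
Proof.
intros Ha. symmetry.
apply (iint_unique (V := R_CompleteNormedModule) (fun t => Rpower t (a - 1) * exp (- t))).
apply is_iint_ext with (2 := is_iint_Jint exp_sg exp_sg_C0 1 1 (Rle_refl 1) Rlt_0_1 exp_sg_stable a 1 Ha).
intros t Ht. change (Rpower t (a - 1) * (exp (- t) * 1) = Rpower t (a - 1) * exp (- t)). ring.
Qed.

Lemma Gamma_1 : Gamma 1 = 1.
Proof.
apply (iint_unique (V := R_CompleteNormedModule) (fun t => Rpower t (1 - 1) * exp (- t))).
apply is_iint_eps. intros eps He.
exists (eps / 2). split; [lra|]. intros a b Ha Hb.
assert (Hi : 0 < / (eps / 2)) by (apply Rinv_0_lt_compat; lra).
exists (exp (- a) - exp (- b)). split.
- apply is_RInt_ext with (fun t => exp (- t)).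
  { intros t [Ht _]. assert (0 < Rmin a b) by (apply Rmin_glb_lt; lra).
    rewrite Rminus_diag, Rpower_O by lra. symmetry. apply Rmult_1_l. }
  replace (exp (- a) - exp (- b)) with (minus (- exp (- b)) (- exp (- a)))
    by (unfold minus, plus, opp; simpl; ring).
  apply (is_RInt_derive (V := R_CompleteNormedModule) (fun t => - exp (- t)) (fun t => exp (- t))).
  + intros t _. auto_derive; [easy|ring].
  + intros t _. apply (ex_derive_continuous (V := R_NormedModule)). auto_derive. easy.
- change (Rabs (exp (- a) - exp (- b) - 1) < eps).
  assert (B1 := exp_ineq1_le (- a)). assert (B2 : exp (- a) <= 1).
  { rewrite <- exp_0. apply exp_le_compat. lra. }
  assert (B3 := exp_pos (- b)).
  assert (B4 : exp (- b) < eps / 2).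
  { apply Rle_lt_trans with (/ b); [apply exp_opp_le_inv; lra|].
    rewrite <- (Rinv_inv (eps / 2)). apply Rinv_lt_contravar; [nra|easy]. }
  apply Rabs_def1; lra.
Qed.

(** The identity is [Jint_mul] for [e^(-t)] evaluated at 1. Positivity of the integrand shows that
    neither Gamma value is zero, so the normalising factors of [neg_power] can be cancelled. *)
Lemma Gamma_reflection a : 0 < a < 1 -> Gamma a * Gamma (1 - a) = beta_int (1 - a) /\ 0 < beta_int (1 - a).
Proof.
intros Ha. split.
- assert (H := Jint_mul exp_sg exp_sg_C0 1 1 (Rle_refl 1) Rlt_0_1 exp_sg_stable a (1 - a) ltac:(lra) ltac:(lra) ltac:(lra) 1).
  assert (L := Jint_linear exp_sg exp_sg_C0 1 1 (Rle_refl 1) Rlt_0_1 exp_sg_stable a ltac:(lra)).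
  rewrite (Jint_exp_sg (1 - a)), (Jint_exp_sg 1), Gamma_1 in H by lra.
  replace (Gamma (1 - a)) with (scal (Gamma (1 - a)) (1 : R_CompleteNormedModule)) in H by apply Rmult_1_r.
  rewrite (lin_scal _ L), Jint_exp_sg in H by lra.
  change (Gamma (1 - a) * Gamma a = beta_int (1 - a) * 1) in H. lra.
- apply (iint_positive (beta_kernel (1 - a) 0)).
  + intros t Ht. now apply continuous_beta_kernel.
  + intros t Ht. apply beta_kernel_pos.
  + apply is_iint_beta. lra.
Qed.

(** * Fractional powers and the smoothing of the semigroup *)

Section FractionalPowers.

Context {X : CompleteNormedModule R_AbsRing} (T : R -> X -> X).
Context (HT : C0_semigroup T) (M nu : R) (HM : 1 <= M) (Hnu : 0 < nu).
Context (Hstable : forall t, 0 <= t -> forall x, norm (T t x) <= M * exp (- nu * t) * norm x).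

Lemma neg_power_0 x : neg_power T 0 x = x.
Proof. unfold neg_power. destruct (Req_EM_T 0 0); easy. Qed.

Lemma neg_power_pos a x : 0 < a -> neg_power T a x = scal (/ Gamma a) (Jint T a x).
Proof. intros Ha. unfold neg_power. destruct (Req_EM_T a 0); [lra|reflexivity]. Qed.

Lemma neg_power_1 x : neg_power T 1 x = Jint T 1 x.
Proof. rewrite neg_power_pos, Gamma_1, Rinv_1 by lra. exact (scal_one (Jint T 1 x)). Qed.

Lemma neg_power_linear a : 0 <= a -> is_linear (neg_power T a).
Proof.
intros [Ha|<-].
- apply is_linear_ext with (fun x => scal (/ Gamma a) (Jint T a x)).
  { intros x. symmetry. now apply neg_power_pos. }
  apply is_linear_comp; [now apply (Jint_linear T HT M nu)|].
  exact (is_linear_scal_r (V := X) (/ Gamma a) Rmult_comm).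
- apply is_linear_ext with (fun x => x); [|apply is_linear_id].
  intros x. symmetry. apply neg_power_0.
Qed.

Lemma neg_power_commute a (B : X -> X) : 0 <= a -> is_linear B ->
  (forall t x, 0 < t -> B (T t x) = T t (B x)) -> forall x, neg_power T a (B x) = B (neg_power T a x).
Proof.
intros [Ha|<-] HB H x; [|now rewrite !neg_power_0].
rewrite !neg_power_pos, (lin_scal B HB) by easy. f_equal. now apply (Jint_commute T HT M nu).
Qed.

Lemma neg_power_sg a t x : 0 <= a -> 0 <= t -> neg_power T a (T t x) = T t (neg_power T a x).
Proof.
intros Ha Ht. apply neg_power_commute; [easy|now apply (sg_linear T HT)|].
intros s y Hs. apply (sg_comm T HT); lra.
Qed.

Lemma neg_power_mul a x : 0 <= a <= 1 -> neg_power T a (neg_power T (1 - a) x) = Jint T 1 x.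
Proof.
(* At either endpoint one factor is the identity by definition; [Jint_mul] covers the exponents
   strictly between. *)
intros Ha. destruct (Req_dec a 0) as [->|H0].
{ rewrite neg_power_0, Rminus_0_r. apply neg_power_1. }
destruct (Req_dec a 1) as [->|H1].
{ rewrite Rminus_diag, neg_power_0. apply neg_power_1. }
rewrite !neg_power_pos by lra.
rewrite (lin_scal (Jint T a)) by (apply (Jint_linear T HT M nu); try easy; lra).
rewrite (Jint_mul T HT M nu HM Hnu Hstable) by lra.
destruct (Gamma_reflection a) as [E Hp]; [lra|]. rewrite <- E in *.
vec X. field. split; intros E0; rewrite E0 in Hp; lra.
Qed.

Context (al : R) (Hal : 0 <= al < 1).

(** Applying [A^(-(1-al))] turns [A^(-al)] into the injective operator [A^(-1)]. This gives the
    uniqueness that the [iota] in [power] relies on. *)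
Lemma neg_power_inj x y : neg_power T al x = neg_power T al y -> x = y.
Proof.
intros H. assert (L := neg_power_linear al (proj1 Hal)).
assert (E : neg_power T al (minus x y) = zero).
{ rewrite (lin_minus _ L), H. vec X. }
assert (E' : Jint T 1 (minus x y) = zero).
{ rewrite <- (neg_power_mul (1 - al)) by lra. replace (1 - (1 - al)) with al by ring.
  rewrite E. apply (lin_zero _ (neg_power_linear (1 - al) ltac:(lra))). }
apply (Jint1_inj T HT M nu HM Hnu Hstable) in E'.
replace x with (plus (minus x y) y) by vec X. rewrite E'. vec X.
Qed.

Lemma power_neg_power y : power T al (neg_power T al y) = y.
Proof.
unfold power. apply (iota_unique (V := X)); [|reflexivity].
intros z Hz. now apply neg_power_inj.
Qed.

Lemma neg_power_power x : power_dom T al x -> neg_power T al (power T al x) = x.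
Proof. intros [y <-]. now rewrite power_neg_power. Qed.

(** Through this isometry, continuity and Lipschitz conditions in the norm of [X_al] become
    conditions on functions with values in [X]. *)
Lemma norm_pow_neg_power x y :
  norm_pow T al (minus (neg_power T al x) (neg_power T al y)) = norm (minus x y).
Proof.
unfold norm_pow. rewrite <- (lin_minus _ (neg_power_linear al (proj1 Hal))).
now rewrite power_neg_power.
Qed.

Lemma power_dom_neg_power y : power_dom T al (neg_power T al y).
Proof. now exists y. Qed.

(** [Jint T 1] applied to the difference quotients of the orbit of [y] tends to [Jint T 1 w] by
    boundedness; by [Jint1_shift] it is also minus the averages of that orbit, which tend to
    [- y]. *)
Lemma generator_Jint1 y w : generator T y w -> y = Jint T 1 (opp w).
Proof.
intros H. assert (L := Jint_linear T HT M nu HM Hnu Hstable 1 Rlt_0_1).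
destruct (linear_norm _ L) as [N [HN E]].
apply eq_of_norm_eps. intros eps He.
destruct (mean_sg_lim T HT M nu HM Hnu Hstable y (eps / 2)) as [d1 [Hd1 H1]]; [lra|].
assert (H2 := proj1 (filterlim_eps _ _ _) H (eps / (2 * N)) ltac:(apply Rdiv_lt_0_compat; lra)).
apply at_right_eps in H2. destruct H2 as [d2 [Hd2 H2]].
assert (Hm : 0 < Rmin d1 d2) by now apply Rmin_glb_lt.
assert (Hm1 := Rmin_l d1 d2). assert (Hm2 := Rmin_r d1 d2).
pose (h := Rmin d1 d2 / 2). specialize (H1 h ltac:(unfold h; lra)). specialize (H2 h ltac:(unfold h; lra)).
assert (Hh : 0 < h) by (unfold h; lra).
rewrite <- (Jint1_shift T HT M nu) in H1 by (easy || lra).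
set (m := scal (/ h) (minus (Jint T 1 y) (T h (Jint T 1 y))) : X) in H1.
apply Rle_lt_trans with (1 := norm_minus_triangle _ m _).
rewrite norm_minus_sym.
assert (B : norm (minus m (Jint T 1 (opp w))) <= N * norm (minus (scal (/ h) (minus (T h y) y)) w)).
{ replace (norm (minus m (Jint T 1 (opp w)))) with (norm (Jint T 1 (minus (scal (/ h) (minus (T h y) y)) w))); [apply E|].
  rewrite <- norm_opp_eq. apply (f_equal norm). unfold m.
  rewrite <- (Jint_sg T HT M nu) by (easy || lra).
  rewrite <- (lin_minus _ L), <- (lin_scal _ L), <- (lin_minus _ L).
  replace (opp (Jint T 1 (minus (scal (/ h) (minus (T h y) y)) w)))
    with (scal (-1) (Jint T 1 (minus (scal (/ h) (minus (T h y) y)) w))) by vec X.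
  rewrite <- (lin_scal _ L). f_equal. vec X. }
assert (B' : N * norm (minus (scal (/ h) (minus (T h y) y)) w) < eps / 2).
{ apply Rlt_le_trans with (N * (eps / (2 * N))); [now apply Rmult_lt_compat_l|]. right. field. lra. }
lra.
Qed.

(** Complex differentiability at the real point [t], restricted to positive real increments, is
    differentiability of the orbit from the right. *)
Lemma analytic_generator t x : analytic_semigroup T -> 0 < t -> exists w, generator T (T t x) w.
Proof.
intros [_ [k [S [Hk [_ [HS [_ [Hhol _]]]]]]]] Ht.
assert (Hsec : sector k (RtoC t)).
{ split; simpl; [easy|]. rewrite Rabs_R0. now apply Rmult_lt_0_compat. }
(* The vector is [x + i 0]; for real increments the first component of the complex derivative is the
   derivative of the original orbit. *)
destruct (Hhol (RtoC t) (x, zero) Hsec) as [[d1 d2] [_ Hd]].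
exists d1. apply filterlim_eps; [apply at_right_proper_filter|]. intros eps He.
assert (Hs2 : 0 < sqrt 2) by (apply sqrt_lt_R0; lra).
(* The factor [sqrt 2] comes from comparing the product norm on the complex plane with the maximum
   norm. *)
pose (e := eps / 2 / sqrt 2).
assert (Hep : 0 < e) by (unfold e; apply Rdiv_lt_0_compat; lra).
destruct (Hd (RtoC t) (fun P HP => HP) (mkposreal e Hep)) as [d Hloc].
apply at_right_eps. exists d. split; [apply cond_pos|]. intros h Hh.
assert (Hball : ball (RtoC t) d (RtoC (t + h))).
{ split; simpl.
  - change (Rabs (t + h - t) < d). replace (t + h - t) with h by ring. rewrite Rabs_pos_eq; lra.
  - apply ball_center. }
specialize (Hloc (RtoC (t + h)) Hball). simpl in Hloc.
rewrite !HS in Hloc by lra. cbn [fst snd] in Hloc.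
set (u := minus (minus (T (t + h) x) (T t x)) (scal h d1)).
assert (B1 : norm u <= e * (sqrt 2 * h)).
{ match type of Hloc with norm ?a <= _ * norm ?b => set (v := a) in Hloc; set (w := b) in Hloc end.
  assert (Ev : fst v = u).
  { unfold v, u, cscal. simpl.
    replace (t + h + - t) with h by ring.
    change (plus (minus (T (t + h) x) (T t x)) (opp (minus (scal (plus (t + h) (opp t)) d1) (scal (plus 0 (opp 0)) d2)))
      = minus (minus (T (t + h) x) (T t x)) (scal h d1)).
    vec X; unfold plus, opp; simpl; ring. }
  rewrite <- Ev.
  assert (Bv : norm (fst v) <= norm v).
  { destruct v as [v1 v2]. simpl fst. apply Rle_trans with (2 := proj1 (norm_prod v1 v2)). apply Rmax_l. }
  apply Rle_trans with (1 := Bv), Rle_trans with (1 := Hloc).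
  apply Rmult_le_compat_l; [lra|].
  assert (Bw : norm w <= sqrt 2 * Rmax (norm (t + h + - t)) (norm (0 + - 0))).
  { apply (norm_prod (U := R_NormedModule) (V := R_NormedModule)). }
  apply Rle_trans with (1 := Bw). apply Rmult_le_compat_l; [lra|].
  apply Rmax_lub.
  - change (Rabs (t + h + - t) <= h). replace (t + h + - t) with h by ring. rewrite Rabs_pos_eq; lra.
  - change (Rabs (0 + - 0) <= h). replace (0 + - 0) with 0 by ring. rewrite Rabs_R0. lra. }
apply Rle_lt_trans with (norm (scal (/ h) u)).
{ apply Req_le. apply (f_equal norm). unfold u. rewrite Rplus_comm, (sg_add T HT) by lra.
  vec X. field. lra. }
apply Rle_lt_trans with (1 := Req_le _ _ (norm_scal_eq (/ h) u)).
rewrite Rabs_pos_eq by (left; apply Rinv_0_lt_compat; lra).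
apply Rle_lt_trans with (/ h * (e * (sqrt 2 * h))).
- apply Rmult_le_compat_l; [left; apply Rinv_0_lt_compat; lra|easy].
- replace (/ h * (e * (sqrt 2 * h))) with (eps / 2) by (unfold e; field; split; lra). lra.
Qed.

(** [T t x] lies in the domain of the generator, hence in the range of
    [A^(-1) = A^(-al) A^(-(1-al))]. *)
Lemma power_dom_sg t x : analytic_semigroup T -> 0 < t -> power_dom T al (T t x).
Proof.
intros HA Ht. destruct (analytic_generator t x HA Ht) as [w Hw].
apply generator_Jint1 in Hw. rewrite Hw.
exists (neg_power T (1 - al) (opp w)). apply neg_power_mul. lra.
Qed.

(** [opnorm_le] cannot be applied, as it presupposes a bounded operator. Homogeneity and additivity
    are obtained by applying [A^(-al)]; homogeneity then spreads the bound from the unit ball to the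
    whole space. *)
Lemma power_sg_bound t c : 0 < t -> analytic_semigroup T ->
  Rbar_le (opnorm (fun x => power T al (T t x))) (Finite c) ->
  is_linear (fun x => power T al (T t x)) /\ forall x, norm (power T al (T t x)) <= c * norm x.
Proof.
intros Ht HA Hc. assert (L := neg_power_linear al (proj1 Hal)).
assert (LT := sg_linear T HT t ltac:(lra)).
assert (Hs : forall (k : R) (x : X), power T al (T t (scal k x)) = scal k (power T al (T t x))).
{ intros k x. apply neg_power_inj. rewrite (lin_scal _ L), !neg_power_power by now apply power_dom_sg.
  apply (lin_scal _ LT). }
assert (Hb : forall x : X, norm x <= 1 -> norm (power T al (T t x)) <= c).
{ intros x Hx. unfold opnorm in Hc.
  assert (HL := Lub_Rbar_correct (fun r => exists x : X, norm x <= 1 /\ r = norm (power T al (T t x)))).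
  destruct HL as [Hub _]. assert (H := Hub (norm (power T al (T t x)))).
  exact (Rbar_le_trans (Finite _) _ (Finite c) (H (ex_intro _ x (conj Hx eq_refl))) Hc). }
assert (Hn : forall x : X, norm (power T al (T t x)) <= c * norm x).
{ intros x. destruct (Req_dec (norm x) 0) as [Hx|Hx].
  - assert (Ex : x = scal 0 x).
    { replace (scal 0 x) with (zero : X) by vec X. now apply (norm_eq_zero (V := X)). }
    rewrite Ex, Hs, !norm_scal_eq, Rabs_R0. lra.
  - assert (Hx' : 0 < norm x) by (generalize (norm_pos x); lra).
    assert (H : norm (power T al (T t (scal (/ norm x) x))) <= c).
    { apply Hb. rewrite norm_scal_eq, Rabs_pos_eq, Rinv_l by (try left; try apply Rinv_0_lt_compat; lra). lra. }
    rewrite Hs, norm_scal_eq, Rabs_pos_eq in H by (left; now apply Rinv_0_lt_compat).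
    apply Rmult_le_reg_l with (/ norm x); [now apply Rinv_0_lt_compat|].
    apply Rle_trans with (1 := H). right. field. lra. }
split; [|exact Hn]. apply (lin_intro _ c); [|exact Hs|exact Hn].
intros x y. apply neg_power_inj. rewrite (lin_plus _ L), !neg_power_power by now apply power_dom_sg.
apply (lin_plus _ LT).
Qed.

End FractionalPowers.

(** * Bounded invertibility of [I - T(omega)] *)

Section Resolvent.

Context {X : CompleteNormedModule R_AbsRing} (T : R -> X -> X).
Context (HT : C0_semigroup T) (M nu : R) (HM : 1 <= M) (Hnu : 0 < nu).
Context (Hstable : forall t, 0 <= t -> forall x, norm (T t x) <= M * exp (- nu * t) * norm x).
Context (omega : R) (Homega : 0 < omega).

(** Telescoping: the increment from [k omega] to [(k + 1) omega] is [T(k omega)] applied to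
    [x - T(omega) x]. *)
Lemma sg_iter_bound x n :
  norm (minus x (T (INR n * omega) x)) <= INR n * M * norm (minus x (T omega x)).
Proof.
induction n as [|n IH].
- simpl INR. rewrite !Rmult_0_l, (sg_zero T HT).
  replace (minus x x) with (zero : X) by vec X. rewrite norm_zero_eq. lra.
- assert (Hn : 0 <= INR n * omega) by (apply Rmult_le_pos; [apply pos_INR|lra]).
  rewrite S_INR.
  apply Rle_trans with (1 := norm_minus_triangle _ (T (INR n * omega) x) _).
  replace ((INR n + 1) * omega) with (INR n * omega + omega) by ring.
  rewrite (sg_add T HT) by lra.
  rewrite <- (lin_minus (T (INR n * omega))) by now apply (sg_linear T HT).
  assert (B := sg_norm T M nu HM Hnu Hstable (INR n * omega) (minus x (T omega x)) Hn). lra.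
Qed.

(** [T omega] itself may have norm above 1. Choosing [n > 2 M / (nu omega)] and using
    [e^(-y) <= 1 / y] gives [|T(n omega) x| <= |x| / 2], and the telescoping bound controls
    [x - T(n omega) x]. *)
Lemma I_minus_sg_bounded_below : exists N, 0 < N /\
  forall x : X, norm x <= N * norm (minus x (T omega x)).
Proof.
destruct (INR_unbounded (2 * M / (nu * omega))) as [n Hn].
assert (Hno : 0 < nu * omega) by nra.
assert (Hn0 : 0 < INR n).
{ apply Rle_lt_trans with (2 := Hn). apply Rdiv_le_0_compat; lra. }
exists (2 * (INR n * M)). split; [apply Rmult_lt_0_compat; [lra|apply Rmult_lt_0_compat; lra]|].
intros x.
assert (B := sg_iter_bound x n).
assert (B2 := Hstable (INR n * omega) ltac:(nra) x).
assert (Bx := norm_pos x).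
assert (B3 : M * exp (- nu * (INR n * omega)) <= / 2).
{ replace (- nu * (INR n * omega)) with (- (nu * omega * INR n)) by ring.
  apply Rle_trans with (M * / (nu * omega * INR n)).
  - apply Rmult_le_compat_l; [lra|]. apply exp_opp_le_inv. now apply Rmult_lt_0_compat.
  - apply Rmult_le_reg_r with (2 * (nu * omega * INR n)); [apply Rmult_lt_0_compat; [lra|now apply Rmult_lt_0_compat]|].
    apply (Rmult_lt_compat_l (nu * omega)) in Hn; [|easy].
    replace (nu * omega * (2 * M / (nu * omega))) with (2 * M) in Hn by (field; lra).
    field_simplify; [lra|]. split; [lra|]. split; lra. }
assert (B4 := norm_le_minus x (T (INR n * omega) x)).
assert (B5 : M * exp (- nu * (INR n * omega)) * norm x <= / 2 * norm x) by now apply Rmult_le_compat_r.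
lra.
Qed.

(** The solution is the Neumann series of the [T(n omega) y], with majorant geometric in
    [e^(-nu omega)]. Applying [T omega] drops its first term [y]. *)
Lemma I_minus_sg_surj (y : X) : exists x : X, minus x (T omega x) = y.
Proof.
assert (Hq : exp (- nu * omega) < 1) by (rewrite <- exp_0; apply exp_increasing; nra).
destruct (ex_series_le (fun n => T (INR n * omega) y) (fun n => M * norm y * exp (- nu * omega) ^ n)) as [l Hl].
- intros n. assert (Hn : 0 <= INR n * omega) by (apply Rmult_le_pos; [apply pos_INR|lra]).
  apply Rle_trans with (1 := Hstable _ Hn y).
  replace (exp (- nu * (INR n * omega))) with (exp (- nu * omega) ^ n).
  2:{ rewrite <- Rpower_pow by apply exp_pos. unfold Rpower. rewrite ln_exp. f_equal. ring. }
  lra.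
- apply (ex_series_scal (V := R_NormedModule) (M * norm y)).
  apply ex_series_geom. rewrite Rabs_pos_eq; [easy|left; apply exp_pos].
- exists l.
  assert (H1 : is_series (fun n => T (INR (S n) * omega) y) (T omega l)).
  { unfold is_series. apply filterlim_ext with (fun n => T omega (sum_n (fun n => T (INR n * omega) y) n)).
    - intros n. induction n as [|n IH].
      + rewrite !sum_O, <- (sg_add T HT) by (simpl; lra). f_equal. simpl. ring.
      + rewrite !sum_Sn, <- IH, S_INR.
        etransitivity; [exact (lin_plus (T omega) (sg_linear T HT omega ltac:(lra)) _ _)|].
        f_equal. rewrite <- (sg_add T HT); [f_equal; rewrite !S_INR; ring|lra|].
        apply Rmult_le_pos; [|lra]. generalize (pos_INR n). lra.
    - eapply filterlim_comp; [exact Hl|].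
      exact (linear_cont (T omega) l (sg_linear T HT omega ltac:(lra))). }
  assert (H2 : is_series (fun n => T (INR (S n) * omega) y) (minus l y)).
  { apply (is_series_incr_1 (V := X) (fun n => T (INR n * omega) y)).
    assert (E : l = plus (minus l y) (T (INR 0 * omega) y)).
    { simpl INR. rewrite Rmult_0_l, (sg_zero T HT). vec X. }
    exact (eq_ind l (fun u => is_series (fun n => T (INR n * omega) y) u) Hl _ E). }
  assert (E : T omega l = minus l y).
  { apply (filterlim_locally_unique (V := X) _ _ _ H1 H2). }
  rewrite E. vec X.
Qed.

Lemma inv_I_minus_eq x y : minus x (T omega x) = y -> inv_I_minus T omega y = x.
Proof.
intros H. unfold inv_I_minus. apply (iota_unique (V := X)); [|exact H].
intros z Hz. destruct I_minus_sg_bounded_below as [N [HN B]].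
apply minus_eq_zero_norm. apply Rle_trans with (1 := B _).
rewrite (lin_minus (T omega)) by (apply (sg_linear T HT); lra).
replace (minus (minus z x) (minus (T omega z) (T omega x)))
  with (minus (minus z (T omega z)) (minus x (T omega x))) by vec X.
rewrite H, Hz. replace (minus y y) with (zero : X) by vec X. rewrite norm_zero_eq. lra.
Qed.

Lemma inv_I_minus_linear : is_linear (inv_I_minus T omega).
Proof.
assert (LT := sg_linear T HT omega ltac:(lra)).
destruct I_minus_sg_bounded_below as [N [HN B]]. apply (lin_intro _ N).
- intros y1 y2. destruct (I_minus_sg_surj y1) as [x1 H1]. destruct (I_minus_sg_surj y2) as [x2 H2].
  rewrite (inv_I_minus_eq x1 y1 H1), (inv_I_minus_eq x2 y2 H2). apply inv_I_minus_eq.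
  rewrite (lin_plus _ LT), <- H1, <- H2. vec X.
- intros k y. destruct (I_minus_sg_surj y) as [x H].
  rewrite (inv_I_minus_eq x y H). apply inv_I_minus_eq. rewrite (lin_scal _ LT), <- H. vec X.
- intros y. destruct (I_minus_sg_surj y) as [x H]. rewrite (inv_I_minus_eq x y H), <- H. apply B.
Qed.

Lemma inv_I_minus_commute (B : X -> X) : is_linear B -> (forall x, B (T omega x) = T omega (B x)) ->
  forall y, inv_I_minus T omega (B y) = B (inv_I_minus T omega y).
Proof.
intros HB H y. destruct (I_minus_sg_surj y) as [x Hx]. rewrite (inv_I_minus_eq x y Hx).
apply inv_I_minus_eq. now rewrite <- H, <- (lin_minus B HB), Hx.
Qed.

End Resolvent.

(** * Periodic functions and singular integrals *)

Section PeriodicFunctions.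

Context {X : CompleteNormedModule R_AbsRing} (omega : R) (Homega : 0 < omega).
Implicit Types (v w : R -> X).

Definition cperiodic v : Prop := (forall t, v (t + omega) = v t) /\ forall t, continuous v t.

Lemma periodic_nat v t n : (forall t, v (t + omega) = v t) -> v (t + INR n * omega) = v t.
Proof.
intros H. induction n as [|n IH].
- simpl. now rewrite Rmult_0_l, Rplus_0_r.
- rewrite S_INR, <- IH, <- (H (t + INR n * omega)). f_equal. ring.
Qed.

Lemma periodic_representative v t : (forall t, v (t + omega) = v t) ->
  exists s, 0 <= s <= omega /\ v s = v t.
Proof.
(* [n1 + 1] periods are added to make the time nonnegative, and then the whole periods it contains
   are subtracted. *)
intros H. destruct (nfloor_ex (Rabs t / omega)) as [n1 Hn1].
{ apply Rdiv_le_0_compat; [apply Rabs_pos|easy]. }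
assert (Ht : 0 <= t + (INR n1 + 1) * omega).
{ assert (Rabs t < (INR n1 + 1) * omega).
  { apply Rmult_lt_reg_r with (/ omega); [now apply Rinv_0_lt_compat|].
    rewrite Rmult_assoc, Rinv_r, Rmult_1_r by lra. apply Hn1. }
  generalize (Rle_abs (- t)). rewrite Rabs_Ropp. lra. }
destruct (nfloor_ex ((t + (INR n1 + 1) * omega) / omega)) as [n2 [Hn2 Hn2']].
{ now apply Rdiv_le_0_compat. }
exists (t + (INR n1 + 1) * omega - INR n2 * omega). split.
- apply (Rmult_le_compat_r omega) in Hn2; [|lra]. apply (Rmult_lt_compat_r omega) in Hn2'; [|lra].
  unfold Rdiv in Hn2, Hn2'. rewrite Rmult_assoc, Rinv_l, Rmult_1_r in Hn2, Hn2' by lra. lra.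
- rewrite <- (periodic_nat v _ n2 H). rewrite <- (periodic_nat v t (S n1) H). f_equal.
  rewrite S_INR. ring.
Qed.

(** The maximum norm is attained over one period, so its value can serve as the constant [d] of a
    contraction estimate stated pointwise. *)
Lemma cperiodic_max v : cperiodic v -> exists t0, forall t, norm (v t) <= norm (v t0).
Proof.
intros [Hp Hc]. destruct (continuity_ab_maj (fun t => norm (v t)) 0 omega) as [t0 [H0 _]]; [lra| |].
- intros c _. apply continuity_pt_filterlim.
  apply (continuous_comp (U := R_UniformSpace) v (fun x : X => norm x) c); [apply Hc|apply (filterlim_norm (V := X))].
- exists t0. intros t. destruct (periodic_representative v t Hp) as [s [Hs <-]]. now apply H0.
Qed.

Lemma cperiodic_minus v w : cperiodic v -> cperiodic w -> cperiodic (fun t => minus (v t) (w t)).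
Proof.
intros [Hv Cv] [Hw Cw]. split.
- intros t. now rewrite Hv, Hw.
- intros t. apply (continuous_minus (V := X)); [apply Cv|apply Cw].
Qed.

Lemma cperiodic_shift v c : cperiodic v -> cperiodic (fun t => v (t - c)).
Proof.
intros [Hv Cv]. split.
- intros t. rewrite <- (Hv (t - c)). f_equal. ring.
- intros t. apply (continuous_comp (U := R_UniformSpace) (fun t => t - c) v); [|apply Cv].
  apply (continuous_minus (V := R_NormedModule)); [apply continuous_id|apply continuous_const].
Qed.

(** * Contractions on continuous periodic functions *)

Context (Phi : (R -> X) -> R -> X) (q : R) (Hq : q < 1).
Context (HPhi : forall v, cperiodic v -> cperiodic (Phi v)).
Context (Hcontr : forall v w d, cperiodic v -> cperiodic w ->
  (forall t, norm (minus (v t) (w t)) <= d) ->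
  forall t, norm (minus (Phi v t) (Phi w t)) <= q * d).

Lemma contraction_unique v w : cperiodic v -> cperiodic w ->
  (forall t, v t = Phi v t) -> (forall t, w t = Phi w t) -> forall t, v t = w t.
Proof.
intros Cv Cw Hv Hw t.
destruct (cperiodic_max _ (cperiodic_minus v w Cv Cw)) as [t0 H0].
apply minus_eq_zero_norm. apply Rle_trans with (1 := H0 t).
assert (H := Hcontr v w _ Cv Cw H0 t0). rewrite <- Hv, <- Hw in H.
assert (B := norm_pos (minus (v t0) (w t0))). nra.
Qed.

(** Picard iteration from the zero function. The error [K p^n] is uniform in [t], so the pointwise
    limits inherit periodicity and continuity. *)
Lemma contraction_exists : exists v, cperiodic v /\ forall t, v t = Phi v t.
Proof.
(* Nothing bounds [q] from below; the geometric estimates need a nonnegative ratio. *)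
pose (p := Rmax q 0). assert (Hp : 0 <= p < 1) by (split; [apply Rmax_r|apply Rmax_lub_lt; lra]).
assert (Hcontr' : forall v w d, cperiodic v -> cperiodic w ->
  (forall t, norm (minus (v t) (w t)) <= d) ->
  forall t, norm (minus (Phi v t) (Phi w t)) <= p * d).
{ intros v w d Cv Cw H t. apply Rle_trans with (1 := Hcontr v w d Cv Cw H t).
  apply Rmult_le_compat_r; [|apply Rmax_l].
  apply Rle_trans with (2 := H 0). apply norm_pos. }
pose (u := fun n => Nat.iter n Phi (fun _ => zero)).
assert (Cu : forall n, cperiodic (u n)).
{ induction n as [|n IH]; [|now apply HPhi].
  split; [easy|]. intros t. apply continuous_const. }
destruct (cperiodic_max _ (cperiodic_minus _ _ (Cu 1%nat) (Cu 0%nat))) as [t0 H0].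
set (d0 := norm (minus (u 1%nat t0) (u 0%nat t0))) in H0.
assert (Hd0 : 0 <= d0) by apply norm_pos.
assert (Hstep : forall n t, norm (minus (u (S n) t) (u n t)) <= p ^ n * d0).
{ induction n as [|n IH]; intros t.
  - simpl. rewrite Rmult_1_l. apply H0.
  - simpl pow. rewrite Rmult_assoc.
    apply (Hcontr' (u (S n)) (u n) _ (Cu (S n)) (Cu n) IH). }
pose (K := d0 / (1 - p)).
assert (HK : 0 <= K) by (apply Rdiv_le_0_compat; lra).
(* Keeping [- p ^ m] makes the induction exact, since [K * (p ^ m - p ^ S m) = p ^ m * d0]. *)
assert (Hcauchy : forall n m t, (n <= m)%nat -> norm (minus (u m t) (u n t)) <= K * (p ^ n - p ^ m)).
{ intros n m t Hnm. induction Hnm as [|m Hnm IH].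
  - replace (minus (u n t) (u n t)) with (zero : X) by vec X. rewrite norm_zero_eq. lra.
  - apply Rle_trans with (1 := norm_minus_triangle _ (u m t) _).
    assert (B := Hstep m t).
    replace (K * (p ^ n - p ^ S m)) with (p ^ m * d0 + K * (p ^ n - p ^ m)) by (unfold K; simpl; field; lra).
    lra. }
assert (Hpow : forall eps, 0 < eps -> exists n0, forall n, (n0 <= n)%nat -> K * p ^ n < eps).
{ intros eps He. destruct (pow_lt_1_zero p) with (y := eps / (K + 1)) as [n0 Hn0].
  - rewrite Rabs_pos_eq; lra.
  - apply Rdiv_lt_0_compat; lra.
  - exists n0. intros n Hn. specialize (Hn0 n Hn).
    rewrite Rabs_pos_eq in Hn0 by (apply pow_le; lra).
    assert (Hpn : 0 <= p ^ n) by (apply pow_le; lra).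
    apply Rle_lt_trans with ((K + 1) * p ^ n); [nra|].
    apply Rlt_le_trans with ((K + 1) * (eps / (K + 1))); [apply Rmult_lt_compat_l; lra|].
    right. field. lra. }
assert (Hlim : forall t, exists l : X, forall n, norm (minus (u n t) l) <= K * p ^ n).
{ intros t.
  destruct (proj1 (filterlim_locally_cauchy (U := X) (F := eventually) (fun n => u n t))) as [l Hl].
  - intros eps. destruct (Hpow eps (cond_pos eps)) as [n0 Hn0].
    exists (fun n => (n0 <= n)%nat). split; [now exists n0|].
    assert (Hball : forall i j, (n0 <= i)%nat -> (i <= j)%nat -> norm (minus (u j t) (u i t)) < eps).
    { intros i j Hi Hij. apply Rle_lt_trans with (1 := Hcauchy i j t Hij).
      apply Rle_lt_trans with (2 := Hn0 i Hi).
      assert (0 <= p ^ j) by (apply pow_le; lra). nra. }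
    intros i j Hi Hj. destruct (Nat.le_ge_cases i j) as [h|h].
    + apply (norm_compat1 (V := X)). now apply Hball.
    + apply ball_sym, (norm_compat1 (V := X)). now apply Hball.
  - exists l. intros n. apply Rle_plus_epsilon. intros eps He.
    destruct (proj1 (filterlim_eps _ _ _) Hl eps He) as [n1 Hn1].
    specialize (Hn1 (Nat.max n n1) (Nat.le_max_r _ _)).
    assert (B := Hcauchy n (Nat.max n n1) t (Nat.le_max_l _ _)).
    assert (Bp : 0 <= p ^ Nat.max n n1) by (apply pow_le; lra).
    apply Rle_trans with (1 := norm_minus_triangle _ (u (Nat.max n n1) t) _).
    rewrite norm_minus_sym. nra. }
destruct (ClassicalEpsilon.choice (fun t l => forall n, norm (minus (u n t) l) <= K * p ^ n) Hlim) as [v Hv].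
assert (Cv : cperiodic v).
{ split.
  - intros t. apply eq_of_norm_eps. intros eps He. destruct (Hpow (eps / 2)) as [n Hn]; [lra|].
    specialize (Hn n (Nat.le_refl n)).
    apply Rle_lt_trans with (1 := norm_minus_triangle _ (u n t) _).
    assert (B1 := Hv (t + omega) n). assert (B2 := Hv t n).
    rewrite (proj1 (Cu n)) in B1. rewrite norm_minus_sym. lra.
  - intros t. apply continuous_eps. intros eps He. destruct (Hpow (eps / 3)) as [n Hn]; [lra|].
    specialize (Hn n (Nat.le_refl n)).
    destruct (proj1 (continuous_eps _ t) (proj2 (Cu n) t) (eps / 3)) as [d [Hd H]]; [lra|].
    exists d. split; [easy|]. intros s Hs. specialize (H s Hs).
    apply Rle_lt_trans with (1 := norm_minus_triangle _ (u n s) _).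
    assert (B1 := Hv s n). assert (B2 := Hv t n).
    assert (B3 := norm_minus_triangle (u n s) (u n t) (v t)).
    rewrite norm_minus_sym. lra. }
exists v. split; [exact Cv|]. intros t. apply eq_of_norm_eps. intros eps He.
destruct (Hpow (eps / 2)) as [n Hn]; [lra|].
assert (Hn1 := Hn n (Nat.le_refl n)). assert (Hn2 := Hn (S n) (Nat.le_succ_diag_r n)).
assert (B1 := Hv t (S n)).
assert (B2 := Hcontr' (u n) v (K * p ^ n) (Cu n) Cv (fun s => Hv s n) t).
change (Phi (u n) t) with (u (S n) t) in B2.
apply Rle_lt_trans with (1 := norm_minus_triangle _ (u (S n) t) _).
rewrite norm_minus_sym.
assert (Bp : 0 <= K * p ^ n) by (apply Rmult_le_pos; [easy|apply pow_le; lra]).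
nra.
Qed.

End PeriodicFunctions.

(** * Convolution with the singular family [A^al T(r)] *)

Section SingularIntegral.

Context {X : CompleteNormedModule R_AbsRing} (T : R -> X -> X).
Context (HT : C0_semigroup T) (M nu : R) (HM : 1 <= M) (Hnu : 0 < nu).
Context (Hstable : forall t, 0 <= t -> forall x, norm (T t x) <= M * exp (- nu * t) * norm x).
Context (al Mal omega : R) (Hal : 0 <= al < 1) (HMal : 0 < Mal) (Homega : 0 < omega).
Context (HQ : forall t, 0 < t -> is_linear (fun x => power T al (T t x)) /\
  forall x, power_dom T al (T t x) /\ norm (power T al (T t x)) <= Mal * Rpower t (- al) * norm x).

Definition sg_int (g : R -> X) : X := RInt (fun r => T (Rmax 0 r) (g r)) 0 omega.

Lemma is_RInt_sg_fun (g : R -> X) a b : (forall r, continuous g r) ->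
  is_RInt (fun r => T (Rmax 0 r) (g r)) a b (RInt (fun r => T (Rmax 0 r) (g r)) a b).
Proof.
intros Hg. apply (RInt_correct (fun r => T (Rmax 0 r) (g r))). apply ex_RInt_continuous.
intros r _. apply (continuous_sg_max T HT M nu HM Hnu Hstable). apply Hg.
Qed.

(** Near [r], [A^al T(s)] factors as [T(s - r/2)] after the fixed bounded operator [A^al T(r/2)],
    which leaves only the strong continuity of [T]. *)
Lemma continuous_power_sg (g : R -> X) : (forall r, continuous g r) ->
  continuous_pos (fun r => power T al (T r (g r))).
Proof.
intros Hg r Hr.
apply continuous_ext_loc with (fun s => T (Rmax 0 (s - r / 2)) (power T al (T (r / 2) (g s)))).
- exists (mkposreal (r / 2) ltac:(lra)). intros s Hs. change (Rabs (s - r) < r / 2) in Hs.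
  apply Rabs_def2 in Hs. rewrite Rmax_right by lra.
  apply (neg_power_inj T HT M nu HM Hnu Hstable al Hal).
  rewrite (neg_power_sg T HT M nu HM Hnu Hstable) by lra.
  rewrite !(neg_power_power T HT M nu HM Hnu Hstable al Hal) by (apply HQ; lra).
  rewrite <- (sg_add T HT) by lra. f_equal. ring.
- apply (continuous_sg T HT M nu HM Hnu Hstable) with 1; [lra|intros; apply Rmax_l| |].
  + apply (continuous_comp (U := R_UniformSpace) (fun s => s - r / 2) (Rmax 0)); [|apply continuous_Rmax0].
    apply (continuous_minus (V := R_NormedModule)); [apply continuous_id|apply continuous_const].
  + apply (continuous_comp (U := R_UniformSpace) g (fun x => power T al (T (r / 2) x)) r); [apply Hg|].
    apply (linear_cont (U := X) (V := X)). apply HQ. lra.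
Qed.

Lemma norm_RInt_power_sg (g : R -> X) K a b : (forall r, continuous g r) ->
  (forall r, 0 <= r <= omega -> norm (g r) <= K) -> 0 < a -> a <= b -> b <= omega ->
  norm (RInt (fun r => power T al (T r (g r))) a b)
    <= Mal * K / (1 - al) * (Rpower b (1 - al) - Rpower a (1 - al)).
Proof.
intros Hg HK Ha Hab Hb.
apply (norm_RInt_le (fun r => power T al (T r (g r))) (fun r => Mal * K * Rpower r (1 - al - 1)) a b); [easy| | |].
- intros r Hr. destruct (HQ r ltac:(lra)) as [_ H]. destruct (H (g r)) as [_ B].
  apply Rle_trans with (1 := B). replace (1 - al - 1) with (- al) by ring.
  replace (Mal * K * Rpower r (- al)) with (Mal * Rpower r (- al) * K) by ring.
  apply Rmult_le_compat_l; [|apply HK; lra].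
  apply Rmult_le_pos; [lra|left; apply Rpower_pos].
- apply (RInt_correct (fun r => power T al (T r (g r)))). apply ex_RInt_pos; [|lra|lra].
  now apply continuous_power_sg.
- apply is_RInt_Rpower; lra.
Qed.

(** [A^al] can be moved under the integral sign because [r^(-al)] is integrable at [0]. *)
Lemma sg_int_power (g : R -> X) K : (forall r, continuous g r) ->
  (forall r, 0 <= r <= omega -> norm (g r) <= K) ->
  exists y, neg_power T al y = sg_int g /\
    norm y <= Mal * K * (Rpower omega (1 - al) / (1 - al)).
Proof.
intros Hg HK.
assert (HK0 : 0 <= K) by (apply Rle_trans with (2 := HK 0 ltac:(lra)); apply norm_pos).
set (Q := fun r => power T al (T r (g r))).
pose (c := Mal * K / (1 - al)).
assert (Hc : 0 <= c) by (apply Rdiv_le_0_compat; [apply Rmult_le_pos|]; lra).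
assert (Hex : forall a b, 0 < a -> 0 < b -> ex_RInt Q a b).
{ intros a b. apply ex_RInt_pos. now apply continuous_power_sg. }
assert (Hsmall : forall eps, 0 < eps -> exists d, 0 < d <= omega /\ forall a, 0 < a <= d -> c * Rpower a (1 - al) < eps).
{ intros eps He. pose (e := eps / (c + 1)). assert (Hep : 0 < e) by (apply Rdiv_lt_0_compat; lra).
  exists (Rmin omega (Rpower e (/ (1 - al)))). split.
  { split; [apply Rmin_glb_lt; [easy|apply Rpower_pos]|apply Rmin_l]. }
  intros a Ha. assert (Rpower a (1 - al) <= e).
  { replace e with (Rpower (Rpower e (/ (1 - al))) (1 - al)) by (rewrite Rpower_mult, Rinv_l, Rpower_1; lra).
    apply Rle_Rpower_l; [lra|]. split; [lra|]. apply Rle_trans with (1 := proj2 Ha), Rmin_r. }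
  apply Rle_lt_trans with (c * e); [now apply Rmult_le_compat_l|].
  unfold e. apply Rlt_le_trans with ((c + 1) * (eps / (c + 1))); [apply Rmult_lt_compat_r; [easy|lra]|].
  right. field. lra. }
assert (Hdiff : forall a b, 0 < a <= b -> b <= omega ->
  norm (minus (RInt Q a omega) (RInt Q b omega)) <= c * Rpower b (1 - al)).
{ intros a b Ha Hb. rewrite <- (RInt_Chasles Q a b omega) by (apply Hex; lra).
  assert (B := norm_RInt_power_sg g K a b Hg HK ltac:(lra) ltac:(lra) Hb).
  apply Rle_trans with (norm (RInt Q a b)).
  - apply Req_le. apply (f_equal norm). vec X.
  - apply Rle_trans with (1 := B). apply Rmult_le_compat_l; [easy|]. generalize (Rpower_pos a (1 - al)). lra. }
(* The witness [y] is the integral of [Q] over [(0, omega]], improper at 0, where [Q] may blow up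
   like [r^(-al)]. *)
destruct (proj1 (filterlim_locally_cauchy (U := X) (F := at_right 0) (fun a => RInt Q a omega))) as [y Hy].
{ intros eps. destruct (Hsmall eps (cond_pos eps)) as [d [Hd H]].
  exists (fun a => 0 < a < d). split; [apply at_right_eps; exists d; split; easy|].
  assert (Hball : forall a b, 0 < a < d -> 0 < b < d -> a <= b -> norm (minus (RInt Q a omega) (RInt Q b omega)) < eps).
  { intros a b Ha Hb Hab. apply Rle_lt_trans with (1 := Hdiff a b ltac:(lra) ltac:(lra)). apply H. lra. }
  intros a b Ha Hb. destruct (Rle_or_lt a b) as [h|h].
  - apply ball_sym, (norm_compat1 (V := X)). now apply Hball.
  - apply (norm_compat1 (V := X)). apply Hball; try easy. lra. }
assert (Hnear : forall eps d0, 0 < eps -> 0 < d0 -> exists a, 0 < a < d0 /\ a <= omega /\ norm (minus (RInt Q a omega) y) < eps).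
{ intros eps d0 He Hd0. assert (H := proj1 (filterlim_eps _ _ _) Hy eps He).
  apply at_right_eps in H. destruct H as [d [Hd H]].
  assert (Hm : 0 < Rmin d (Rmin d0 omega)) by (repeat apply Rmin_glb_lt; easy).
  assert (H1 := Rmin_l d (Rmin d0 omega)). assert (H2 := Rmin_r d (Rmin d0 omega)).
  assert (H3 := Rmin_l d0 omega). assert (H4 := Rmin_r d0 omega).
  exists (Rmin d (Rmin d0 omega) / 2). split; [lra|]. split; [lra|]. apply H. lra. }
exists y. split.
- assert (L := neg_power_linear T HT M nu HM Hnu Hstable al (proj1 Hal)).
  destruct (linear_norm _ L) as [N [HN E]].
  apply eq_of_norm_eps. intros eps He.
  destruct (Hnear (eps / (2 * N)) (eps / (2 * (M * K + 1)))) as [a [Ha [Hao Hna]]].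
  { apply Rdiv_lt_0_compat; lra. }
  { apply Rdiv_lt_0_compat; [easy|]. nra. }
  (* Away from 0 the bounded operator [A^(-al)] passes under a proper integral; the remaining piece
     over [[0, a]] is at most [a M K]. *)
  assert (Ea : neg_power T al (RInt Q a omega) = RInt (fun r => T (Rmax 0 r) (g r)) a omega).
  { symmetry. apply is_RInt_unique. apply is_RInt_ext with (fun r => neg_power T al (Q r)).
    - intros r [Hr _]. rewrite Rmin_left in Hr by lra. unfold Q.
      rewrite (neg_power_power T HT M nu HM Hnu Hstable al Hal) by (apply HQ; lra).
      now rewrite Rmax_right by lra.
    - apply is_RInt_linear_map; [exact L|]. apply (RInt_correct Q). apply Hex; lra. }
  assert (Es : sg_int g = plus (RInt (fun r => T (Rmax 0 r) (g r)) 0 a) (neg_power T al (RInt Q a omega))).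
  { rewrite Ea. symmetry.
    apply (RInt_Chasles (fun r => T (Rmax 0 r) (g r))); eexists; now apply is_RInt_sg_fun. }
  rewrite Es.
  replace (minus (neg_power T al y) (plus (RInt (fun r => T (Rmax 0 r) (g r)) 0 a) (neg_power T al (RInt Q a omega))))
    with (opp (plus (neg_power T al (minus (RInt Q a omega) y)) (RInt (fun r => T (Rmax 0 r) (g r)) 0 a))).
  2:{ rewrite (lin_minus _ L). vec X. }
  rewrite norm_opp_eq. apply Rle_lt_trans with (1 := norm_plus_le _ _).
  assert (B1 : norm (neg_power T al (minus (RInt Q a omega) y)) <= N * norm (minus (RInt Q a omega) y)) by apply E.
  assert (B1' : N * norm (minus (RInt Q a omega) y) < eps / 2).
  { apply Rlt_le_trans with (N * (eps / (2 * N))); [now apply Rmult_lt_compat_l|]. right. field. lra. }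
  assert (B2 : norm (RInt (fun r => T (Rmax 0 r) (g r)) 0 a) <= Rabs (a - 0) * (M * K)).
  { apply (norm_RInt_le_abs (fun r => T (Rmax 0 r) (g r)) 0 a); [|now apply is_RInt_sg_fun].
    intros r. rewrite Rmin_left, Rmax_right by lra. intros Hr. rewrite Rmax_right by lra.
    apply Rle_trans with (1 := sg_norm T M nu HM Hnu Hstable r (g r) ltac:(lra)).
    apply Rmult_le_compat_l; [lra|]. apply HK. lra. }
  rewrite Rminus_0_r, Rabs_pos_eq in B2 by lra.
  assert (B2' : a * (M * K) <= eps / 2).
  { assert (0 <= M * K) by nra.
    apply Rle_trans with (eps / (2 * (M * K + 1)) * (M * K + 1)); [|right; field; lra].
    apply Rmult_le_compat; lra. }
  lra.
- apply Rle_plus_epsilon. intros eps He. destruct (Hnear eps 1 He Rlt_0_1) as [a [Ha [Hao Hna]]].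
  assert (B := norm_RInt_power_sg g K a omega Hg HK ltac:(lra) Hao (Rle_refl _)).
  fold Q c in B.
  assert (B2 := norm_le_minus y (RInt Q a omega)). rewrite norm_minus_sym in B2.
  replace (Mal * K * (Rpower omega (1 - al) / (1 - al))) with (c * Rpower omega (1 - al)) by (unfold c; field; lra).
  assert (0 <= c * Rpower a (1 - al)) by (apply Rmult_le_pos; [easy|left; apply Rpower_pos]).
  rewrite Rmult_minus_distr_l in B. lra.
Qed.

Lemma sg_int_minus (g h : R -> X) : (forall r, continuous g r) -> (forall r, continuous h r) ->
  sg_int (fun r => minus (g r) (h r)) = minus (sg_int g) (sg_int h).
Proof.
intros Hg Hh. apply is_RInt_unique.
apply is_RInt_ext with (fun r => minus (T (Rmax 0 r) (g r)) (T (Rmax 0 r) (h r))).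
- intros r _. symmetry. apply lin_minus. apply (sg_linear T HT), Rmax_l.
- apply (is_RInt_minus (fun r => T (Rmax 0 r) (g r)) (fun r => T (Rmax 0 r) (h r)));
  now apply is_RInt_sg_fun.
Qed.

Lemma power_dom_sg_int (g : R -> X) : (forall r, continuous g r) -> power_dom T al (sg_int g).
Proof.
intros Hg.
destruct (continuity_ab_maj (fun r => norm (g r)) 0 omega) as [r0 [H0 _]]; [lra| |].
- intros c _. apply continuity_pt_filterlim.
  apply (continuous_comp (U := R_UniformSpace) g (fun x : X => norm x) c); [apply Hg|apply (filterlim_norm (V := X))].
- destruct (sg_int_power g (norm (g r0)) Hg H0) as [y [Hy _]]. now exists y.
Qed.

Lemma norm_power_sg_int_minus (g h : R -> X) K :
  (forall r, continuous g r) -> (forall r, continuous h r) ->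
  (forall r, 0 <= r <= omega -> norm (minus (g r) (h r)) <= K) ->
  norm (minus (power T al (sg_int g)) (power T al (sg_int h)))
    <= Mal * K * (Rpower omega (1 - al) / (1 - al)).
Proof.
intros Hg Hh HK.
assert (L := neg_power_linear T HT M nu HM Hnu Hstable al (proj1 Hal)).
destruct (sg_int_power (fun r => minus (g r) (h r)) K) as [y [Hy Hn]]; [|exact HK|].
- intros r. apply (continuous_minus (V := X)); [apply Hg|apply Hh].
- replace (minus (power T al (sg_int g)) (power T al (sg_int h))) with y; [exact Hn|].
  apply (neg_power_inj T HT M nu HM Hnu Hstable al Hal).
  rewrite Hy, sg_int_minus, (lin_minus _ L) by easy.
  now rewrite !(neg_power_power T HT M nu HM Hnu Hstable al Hal) by now apply power_dom_sg_int.
Qed.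

(** The substitution [r = t - s] moves the dependence on [t] from the singular kernel and the
    endpoints to [f], so continuity in [t] will follow from uniform continuity of [f]. *)
Lemma RInt_convolution (f : R -> X) t : (forall s, continuous f s) ->
  RInt (fun s => T (t - s) (f s)) (t - omega) t = sg_int (fun r => f (t - r)).
Proof.
intros Hf. apply is_RInt_unique.
assert (Hc : forall r, continuous (fun r => f (t - r)) r).
{ intros r. apply (continuous_comp (U := R_UniformSpace) (fun r => t - r) f); [|apply Hf].
  apply (continuous_minus (V := R_NormedModule)); [apply continuous_const|apply continuous_id]. }
assert (H : is_RInt (fun r => T (Rmax 0 r) (f (t - r))) (-1 * (t - omega) + t) (-1 * t + t)
              (opp (sg_int (fun r => f (t - r))))).
{ replace (-1 * (t - omega) + t) with omega by ring. replace (-1 * t + t) with 0 by ring.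
  apply (is_RInt_swap (V := X)). now apply (is_RInt_sg_fun (fun r => f (t - r))). }
apply is_RInt_comp_lin in H. apply (is_RInt_scal _ _ _ (-1)) in H.
replace (sg_int (fun r => f (t - r))) with (scal (-1) (opp (sg_int (fun r => f (t - r)))) : X) by vec X.
revert H. apply is_RInt_ext. intros s [_ Hs]. rewrite Rmax_right in Hs by lra.
rewrite Rmax_right by lra.
replace (-1 * s + t) with (t - s) by ring. replace (t - (t - s)) with s by ring. vec X.
Qed.

End SingularIntegral.

(** * Mild solutions *)

Lemma opnorm_nonneg {U : CompleteNormedModule R_AbsRing} (B : U -> U) : 0 <= real (opnorm B).
Proof.
unfold opnorm. assert (HL := Lub_Rbar_correct (fun r => exists x : U, norm x <= 1 /\ r = norm (B x))).
destruct (Lub_Rbar _) as [c| |]; try apply Rle_refl. destruct HL as [Hub _].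
apply Rle_trans with (norm (B zero)); [apply norm_pos|].
apply (Hub (norm (B zero))). exists zero. split; [|reflexivity]. rewrite norm_zero_eq. lra.
Qed.

Lemma opnorm_le_compat {U : CompleteNormedModule R_AbsRing} (B : U -> U) (x : U) (c : R) :
  is_linear B -> norm x <= c -> norm (B x) <= real (opnorm B) * c.
Proof.
intros HB Hx. apply Rle_trans with (1 := opnorm_le B HB x).
apply Rmult_le_compat_l; [apply opnorm_nonneg|exact Hx].
Qed.

Section MildSolutions.

Context {X : CompleteNormedModule R_AbsRing} (D : X -> Prop) (A : X -> X) (T : R -> X -> X).
Context (omega xi tau alpha : R) (G : R -> X -> X) (F : R -> X -> X -> X).
Context (a0 a1 L Mal M nu : R).
Context (HlinA : linear_on D A) (HA : analytic_semigroup T) (Hgen : neg_generates D A T).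
Context (HT : C0_semigroup T) (HM : 1 <= M) (Hnu : 0 < nu).
Context (Hstable : forall t, 0 <= t -> forall x, norm (T t x) <= M * exp (- nu * t) * norm x).
Context (Homega : 0 < omega) (Hal : 0 <= alpha < 1).
Context (HG : continuous_G D A T alpha G) (HF : continuous_F T alpha F).
Context (HGper : forall t x, power_dom T alpha x -> G (t + omega) x = G t x).
Context (HFper : forall t x0 x1, power_dom T alpha x0 -> power_dom T alpha x1 ->
  F (t + omega) x0 x1 = F t x0 x1).
Context (HMal : 0 < Mal).
Context (HQ : forall t, 0 < t -> is_linear (fun x => power T alpha (T t x)) /\
  forall x, power_dom T alpha (T t x) /\ norm (power T alpha (T t x)) <= Mal * Rpower t (- alpha) * norm x).
Context (HFlip : forall t x0 x1 y0 y1,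
  power_dom T alpha x0 -> power_dom T alpha x1 ->
  power_dom T alpha y0 -> power_dom T alpha y1 ->
  norm (minus (F t x0 x1) (F t y0 y1))
    <= a0 * norm_pow T alpha (minus x0 y0) + a1 * norm_pow T alpha (minus x1 y1)).
Context (Ha0 : 0 < a0) (Ha1 : 0 < a1) (HL : 0 <= L).
Context (HGlip : forall t x y, power_dom T alpha x -> power_dom T alpha y ->
  norm (minus (A (G t x)) (A (G t y))) <= L * norm_pow T alpha (minus x y)).

Notation P := (neg_power T alpha).

Lemma linear_on_minus x y : D x -> D y -> A (minus x y) = minus (A x) (A y).
Proof.
destruct HlinA as [_ [Hp Hs]]. intros Hx Hy.
destruct (Hs (-1) y Hy) as [Dy Ey]. destruct (Hp x (scal (-1) y) Hx Dy) as [_ E].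
transitivity (A (plus x (scal (-1) y))); [f_equal; vec X|]. rewrite E.
transitivity (plus (A x) (scal (-1) (A y))); [f_equal; exact Ey|vec X].
Qed.

(** Links the given operator with the integral: on [D] the generator takes the value [- A x], which
    [generator_Jint1] inverts. *)
Lemma domain_Jint1 x : D x -> Jint T 1 (A x) = x.
Proof.
intros Hx. symmetry. replace (A x) with (opp (opp (A x))) by vec X.
apply (generator_Jint1 T HT M nu HM Hnu Hstable). now apply Hgen.
Qed.

(** The continuity and Lipschitz assumptions on [G] concern [A G], with values in [X]; [G] is
    recovered from it by [A^(-1)]. *)
Definition AG_along (v : R -> X) (t : R) : X := A (G t (P (v (t - xi)))).

Definition forcing (v : R -> X) (s : R) : X := minus (F s (P (v s)) (P (v (s - tau)))) (AG_along v s).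

(** The fixed point equation for [v = A^alpha u], [u] a mild solution. *)
Definition mild_map (v : R -> X) (t : R) : X :=
  plus (neg_power T (1 - alpha) (AG_along v t))
       (inv_I_minus T omega (power T alpha (sg_int T omega (fun r => forcing v (t - r))))).

Lemma AG_along_cperiodic v : cperiodic omega v -> cperiodic omega (AG_along v).
Proof.
intros Cv. destruct (cperiodic_shift omega v xi Cv) as [Hp Hc]. split; unfold AG_along.
- intros t. rewrite Hp, HGper; [easy|apply power_dom_neg_power].
- intros t. apply continuous_eps. intros eps He.
  destruct HG as [HD HG'].
  destruct (HG' t (P (v (t - xi))) (power_dom_neg_power T alpha _) eps He) as [d1 [Hd1 H1]].
  destruct (proj1 (continuous_eps _ t) (Hc t) d1 Hd1) as [d2 [Hd2 H2]].
  exists (Rmin d1 d2). split; [now apply Rmin_glb_lt|]. intros s Hs.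
  rewrite <- linear_on_minus by (apply HD, power_dom_neg_power).
  apply H1; [apply power_dom_neg_power| |].
  + apply Rlt_le_trans with (1 := Hs), Rmin_l.
  + rewrite (norm_pow_neg_power T HT M nu HM Hnu Hstable alpha Hal). apply H2.
    apply Rlt_le_trans with (1 := Hs), Rmin_r.
Qed.

Lemma forcing_cperiodic v : cperiodic omega v -> cperiodic omega (forcing v).
Proof.
intros Cv. apply cperiodic_minus; [|now apply AG_along_cperiodic].
destruct Cv as [Hp0 Hc0]. destruct (cperiodic_shift omega v tau (conj Hp0 Hc0)) as [Hp Hc]. split.
- intros t. rewrite Hp, Hp0, HFper; [easy| |]; apply power_dom_neg_power.
- intros t. apply continuous_eps. intros eps He.
  destruct (HF t (P (v t)) (P (v (t - tau))) (power_dom_neg_power T alpha _) (power_dom_neg_power T alpha _) eps He)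
    as [d1 [Hd1 H1]].
  destruct (proj1 (continuous_eps _ t) (Hc0 t) d1 Hd1) as [d2 [Hd2 H2]].
  destruct (proj1 (continuous_eps _ t) (Hc t) d1 Hd1) as [d3 [Hd3 H3]].
  exists (Rmin d1 (Rmin d2 d3)). split; [repeat apply Rmin_glb_lt; easy|]. intros s Hs.
  assert (B1 := Rmin_l d1 (Rmin d2 d3)). assert (B2 := Rmin_r d1 (Rmin d2 d3)).
  assert (B3 := Rmin_l d2 d3). assert (B4 := Rmin_r d2 d3).
  apply H1; try apply power_dom_neg_power; [lra| |];
    rewrite (norm_pow_neg_power T HT M nu HM Hnu Hstable alpha Hal); [apply H2|apply H3]; lra.
Qed.

Lemma continuous_forcing_reflected v t : cperiodic omega v ->
  forall r, continuous (fun r => forcing v (t - r)) r.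
Proof.
intros Cv r. apply (continuous_comp (U := R_UniformSpace) (fun r => t - r) (forcing v)).
- apply (continuous_minus (V := R_NormedModule)); [apply continuous_const|apply continuous_id].
- now apply forcing_cperiodic.
Qed.

Lemma mild_map_cperiodic v : cperiodic omega v -> cperiodic omega (mild_map v).
Proof.
intros Cv. destruct (AG_along_cperiodic v Cv) as [Hp1 Hc1].
destruct (forcing_cperiodic v Cv) as [Hp2 Hc2]. split; unfold mild_map.
- intros t. rewrite Hp1.
  replace (fun r => forcing v (t + omega - r)) with (fun r => forcing v (t - r)); [easy|].
  apply functional_extensionality. intros r. rewrite <- Hp2. f_equal. ring.
- intros t. apply (continuous_plus (V := X)).
  + apply (continuous_comp (U := R_UniformSpace) (AG_along v) (neg_power T (1 - alpha)) t); [apply Hc1|].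
    apply (linear_cont (U := X) (V := X)). apply (neg_power_linear T HT M nu HM Hnu Hstable). lra.
  + apply (continuous_comp (U := R_UniformSpace)
      (fun t => power T alpha (sg_int T omega (fun r => forcing v (t - r)))) (inv_I_minus T omega) t).
    2:{ apply (linear_cont (U := X) (V := X)). now apply (inv_I_minus_linear T HT M nu). }
    apply continuous_eps. intros eps He.
    (* This bounds the integral of [|A^alpha T(r)|] over [(0, omega]], hence the effect on the
       convolution of a uniform change of the forcing. *)
    pose (c := Mal * (Rpower omega (1 - alpha) / (1 - alpha))).
    assert (Hc : 0 < c).
    { apply Rmult_lt_0_compat; [easy|]. apply Rdiv_lt_0_compat; [apply Rpower_pos|lra]. }
    assert (He' : 0 < eps / (2 * c)) by (apply Rdiv_lt_0_compat; lra).
    (* The interval contains all [t - r] and [s - r] with [0 <= r <= omega] and [|s - t| < 1]. *)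
    destruct (unifcont_normed_1d (V := X) (forcing v) (t - omega - 1) (t + 1)) with (eps := mkposreal _ He')
      as [d Hd]; [intros; apply Hc2|].
    exists (Rmin d 1). split; [apply Rmin_glb_lt; [apply cond_pos|lra]|]. intros s Hs.
    assert (Hs1 : Rabs (s - t) < d) by (apply Rlt_le_trans with (1 := Hs), Rmin_l).
    assert (Hs2 : Rabs (s - t) < 1) by (apply Rlt_le_trans with (1 := Hs), Rmin_r).
    apply Rabs_def2 in Hs2.
    apply Rle_lt_trans with (Mal * (eps / (2 * c)) * (Rpower omega (1 - alpha) / (1 - alpha))).
    * apply (norm_power_sg_int_minus T HT M nu HM Hnu Hstable alpha Mal omega Hal HMal Homega HQ);
        try (now apply continuous_forcing_reflected).
      intros r Hr. left. apply (Hd (t - r) (s - r)); [lra|lra|].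
      change (Rabs (s - r - (t - r)) < d). now replace (s - r - (t - r)) with (s - t) by ring.
    * replace (Mal * (eps / (2 * c)) * (Rpower omega (1 - alpha) / (1 - alpha))) with (eps / (2 * c) * c)
        by (unfold c at 2; ring).
      replace (eps / (2 * c) * c) with (eps / 2) by (field; lra). lra.
Qed.

(** The delays leave no trace, as [d] bounds [v - w] at all times. [A G] contributes twice: through
    the forcing, next to [a0 + a1], and through the first term with the norm of [A^(alpha-1)]. *)
Lemma mild_map_contraction v w d : cperiodic omega v -> cperiodic omega w ->
  (forall t, norm (minus (v t) (w t)) <= d) ->
  forall t, norm (minus (mild_map v t) (mild_map w t))
    <= (real (opnorm (inv_I_minus T omega)) * Mal * (a0 + a1 + L)
          * (Rpower omega (1 - alpha) / (1 - alpha))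
        + real (opnorm (neg_power T (1 - alpha))) * L) * d.
Proof.
intros Cv Cw H t.
assert (HAG : forall s, norm (minus (AG_along v s) (AG_along w s)) <= L * d).
{ intros s. unfold AG_along.
  apply Rle_trans with (1 := HGlip s _ _ (power_dom_neg_power T alpha _) (power_dom_neg_power T alpha _)).
  rewrite (norm_pow_neg_power T HT M nu HM Hnu Hstable alpha Hal). now apply Rmult_le_compat_l. }
assert (Hf : forall s, norm (minus (forcing v s) (forcing w s)) <= (a0 + a1 + L) * d).
{ intros s. unfold forcing.
  set (p := F s (P (v s)) (P (v (s - tau)))). set (q := F s (P (w s)) (P (w (s - tau)))).
  replace (minus (minus p (AG_along v s)) (minus q (AG_along w s)))
    with (minus (minus p q) (minus (AG_along v s) (AG_along w s))) by vec X.
  apply Rle_trans with (1 := norm_minus_le _ _).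
  assert (B := HFlip s (P (v s)) (P (v (s - tau))) (P (w s)) (P (w (s - tau)))
    (power_dom_neg_power T alpha _) (power_dom_neg_power T alpha _)
    (power_dom_neg_power T alpha _) (power_dom_neg_power T alpha _)).
  fold p q in B. rewrite !(norm_pow_neg_power T HT M nu HM Hnu Hstable alpha Hal) in B.
  assert (B1 := H s). assert (B2 := H (s - tau)). specialize (HAG s).
  assert (a0 * norm (minus (v s) (w s)) <= a0 * d) by (apply Rmult_le_compat_l; lra).
  assert (a1 * norm (minus (v (s - tau)) (w (s - tau))) <= a1 * d) by (apply Rmult_le_compat_l; lra).
  lra. }
assert (L1 := neg_power_linear T HT M nu HM Hnu Hstable (1 - alpha) ltac:(lra)).
assert (LR := inv_I_minus_linear T HT M nu HM Hnu Hstable omega Homega).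
unfold mild_map.
set (Sv := power T alpha (sg_int T omega (fun r => forcing v (t - r)))).
set (Sw := power T alpha (sg_int T omega (fun r => forcing w (t - r)))).
replace (minus (plus (neg_power T (1 - alpha) (AG_along v t)) (inv_I_minus T omega Sv))
               (plus (neg_power T (1 - alpha) (AG_along w t)) (inv_I_minus T omega Sw)))
  with (plus (neg_power T (1 - alpha) (minus (AG_along v t) (AG_along w t)))
             (inv_I_minus T omega (minus Sv Sw))).
2:{ rewrite (lin_minus _ L1), (lin_minus _ LR). vec X. }
apply Rle_trans with (1 := norm_plus_le _ _).
assert (BS : norm (minus Sv Sw) <= Mal * ((a0 + a1 + L) * d) * (Rpower omega (1 - alpha) / (1 - alpha))).
{ apply (norm_power_sg_int_minus T HT M nu HM Hnu Hstable alpha Mal omega Hal HMal Homega HQ);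
    try (now apply continuous_forcing_reflected). intros r _. apply Hf. }
assert (B1 := opnorm_le_compat _ _ _ L1 (HAG t)).
assert (B2 := opnorm_le_compat _ _ _ LR BS).
apply Rle_trans with (1 := Rplus_le_compat _ _ _ _ B1 B2). right. ring.
Qed.

(** [A^(-alpha) A^(-(1-alpha)) = A^(-1)] cancels [A] in the first term; in the second, [A^(-alpha)]
    commutes with the inverse of [I - T(omega)] and cancels [A^alpha] on the convolution. *)
Lemma neg_power_mild_map v t : cperiodic omega v ->
  P (mild_map v t) =
  plus (G t (P (v (t - xi))))
    (inv_I_minus T omega
       (RInt (fun s => T (t - s)
                (minus (F s (P (v s)) (P (v (s - tau)))) (A (G s (P (v (s - xi)))))))
          (t - omega) t)).
Proof.
intros Cv. assert (LP := neg_power_linear T HT M nu HM Hnu Hstable alpha (proj1 Hal)).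
unfold mild_map. rewrite (lin_plus _ LP). f_equal.
- rewrite (neg_power_mul T HT M nu HM Hnu Hstable) by lra.
  apply domain_Jint1. apply HG, power_dom_neg_power.
- rewrite <- (inv_I_minus_commute T HT M nu HM Hnu Hstable omega Homega P LP).
  2:{ intros x. apply (neg_power_sg T HT M nu HM Hnu Hstable); lra. }
  f_equal.
  rewrite (neg_power_power T HT M nu HM Hnu Hstable alpha Hal).
  2:{ apply (power_dom_sg_int T HT M nu HM Hnu Hstable alpha Mal omega Hal HMal Homega HQ).
      now apply continuous_forcing_reflected. }
  symmetry. apply (RInt_convolution T HT M nu HM Hnu Hstable omega Homega (forcing v)).
  now apply forcing_cperiodic.
Qed.

Lemma mild_solution_of_fixed_point v : cperiodic omega v -> (forall t, v t = mild_map v t) ->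
  periodic_mild_solution A T alpha omega xi tau G F (fun t => P (v t)).
Proof.
intros Cv Hv. split; [split; [|split]|].
- intros t. apply power_dom_neg_power.
- intros t. now rewrite (proj1 Cv).
- intros t eps He. destruct (proj1 (continuous_eps v t) (proj2 Cv t) eps He) as [d [Hd H]].
  exists d. split; [exact Hd|]. intros s Hs.
  rewrite (norm_pow_neg_power T HT M nu HM Hnu Hstable alpha Hal). now apply H.
- intros t. rewrite <- neg_power_mild_map by easy. now rewrite <- Hv.
Qed.

Lemma fixed_point_of_mild_solution u : periodic_mild_solution A T alpha omega xi tau G F u ->
  exists v, cperiodic omega v /\ (forall t, v t = mild_map v t) /\ u = fun t => P (v t).
Proof.
intros [[Hdom [Hper Hcont]] Heq].
assert (Hu : u = fun t => P (power T alpha (u t))).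
{ apply functional_extensionality. intros t. symmetry.
  apply (neg_power_power T HT M nu HM Hnu Hstable alpha Hal), Hdom. }
assert (Cv : cperiodic omega (fun t => power T alpha (u t))).
{ split.
  - intros t. now rewrite Hper.
  - intros t. apply continuous_eps. intros eps He. destruct (Hcont t eps He) as [d [Hd H]].
    exists d. split; [exact Hd|]. intros s Hs.
    rewrite <- (norm_pow_neg_power T HT M nu HM Hnu Hstable alpha Hal).
    rewrite !(neg_power_power T HT M nu HM Hnu Hstable alpha Hal) by apply Hdom. now apply H. }
exists (fun t => power T alpha (u t)). split; [exact Cv|]. split; [|exact Hu].
intros t. apply (neg_power_inj T HT M nu HM Hnu Hstable alpha Hal).
rewrite neg_power_mild_map by exact Cv.
rewrite Hu in Heq. specialize (Heq t).
rewrite <- Heq. reflexivity.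
Qed.

End MildSolutions.

Theorem theorem3p3 (X : CompleteNormedModule R_AbsRing)
  (D : X -> Prop) (A : X -> X) (T : R -> X -> X)
  (omega xi tau alpha : R)
  (G : R -> X -> X) (F : R -> X -> X -> X)
  (a0 a1 L Malpha : R)
  (HlinA : linear_on D A)
  (HclosedA : closed_operator D A)
  (Hanalytic : analytic_semigroup T)
  (Hgen : neg_generates D A T)
  (Hcompact : compact_semigroup T)
  (Hstable : exponentially_stable T)
  (Homega : 0 < omega) (Hxi : 0 < xi) (Htau : 0 < tau)
  (Halpha : 0 <= alpha < 1)
  (HG : continuous_G D A T alpha G)
  (HF : continuous_F T alpha F)
  (HGper : forall t x, power_dom T alpha x -> G (t + omega) x = G t x)
  (HFper : forall t x0 x1, power_dom T alpha x0 -> power_dom T alpha x1 ->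
     F (t + omega) x0 x1 = F t x0 x1)
  (HMalpha : 0 < Malpha /\
     forall t, 0 < t ->
       Rbar_le (opnorm (fun x => power T alpha (T t x)))
               (Finite (Malpha * Rpower t (- alpha))))
  (H1 : 0 < a0 /\ 0 < a1 /\
     forall t x0 x1 y0 y1,
       power_dom T alpha x0 -> power_dom T alpha x1 ->
       power_dom T alpha y0 -> power_dom T alpha y1 ->
       norm (minus (F t x0 x1) (F t y0 y1))
         <= a0 * norm_pow T alpha (minus x0 y0) + a1 * norm_pow T alpha (minus x1 y1))
  (H2 : (forall t, G t zero = zero) /\ 0 <= L /\
     forall t x y, power_dom T alpha x -> power_dom T alpha y ->
       norm (minus (A (G t x)) (A (G t y))) <= L * norm_pow T alpha (minus x y))
  (H3 : real (opnorm (inv_I_minus T omega)) * Malpha * (a0 + a1 + L)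
          * (Rpower omega (1 - alpha) / (1 - alpha))
        + real (opnorm (neg_power T (1 - alpha))) * L < 1) :
  exists! u : R -> X, periodic_mild_solution A T alpha omega xi tau G F u.
Proof.
destruct Hstable as [M [nu [HM [Hnu Hst]]]].
destruct HMalpha as [HM0 HMb]. destruct H1 as [Ha0 [Ha1 HFl]]. destruct H2 as [_ [HL HGl]].
assert (HT : C0_semigroup T) by apply Hanalytic.
(* The assumed operator norm bound says something about [A^alpha T(t)] only once [T(t) x] is known
   to lie in [D(A^alpha)]; this is where analyticity is spent. *)
assert (HQ : forall t, 0 < t -> is_linear (fun x => power T alpha (T t x)) /\
  forall x, power_dom T alpha (T t x) /\
    norm (power T alpha (T t x)) <= Malpha * Rpower t (- alpha) * norm x).
{ intros t Ht.
  destruct (power_sg_bound T HT M nu HM Hnu Hst alpha Halpha t _ Ht Hanalytic (HMb t Ht)) as [Hl Hb].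
  split; [exact Hl|]. intros x. split; [|apply Hb].
  now apply (power_dom_sg T HT M nu HM Hnu Hst). }
pose (Phi := mild_map A T omega xi tau alpha G F).
assert (HPhi : forall v, cperiodic omega v -> cperiodic omega (Phi v)).
{ intros v Cv. unfold Phi. eapply (mild_map_cperiodic D A T) with (M := M) (nu := nu) (Mal := Malpha); eassumption. }
pose (q := real (opnorm (inv_I_minus T omega)) * Malpha * (a0 + a1 + L)
          * (Rpower omega (1 - alpha) / (1 - alpha))
        + real (opnorm (neg_power T (1 - alpha))) * L).
assert (Hcontr : forall v w d, cperiodic omega v -> cperiodic omega w ->
  (forall t, norm (minus (v t) (w t)) <= d) ->
  forall t, norm (minus (Phi v t) (Phi w t)) <= q * d).
{ intros v w d Cv Cw H t. unfold Phi, q. eapply (mild_map_contraction D A T) with (M := M) (nu := nu); eassumption. }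
destruct (contraction_exists omega Homega Phi q H3 HPhi Hcontr) as [v [Cv Hv]].
exists (fun t => neg_power T alpha (v t)). split.
- eapply (mild_solution_of_fixed_point D A T) with (M := M) (nu := nu) (Mal := Malpha); eassumption.
- intros u Hu.
  assert (Hfp : exists w, cperiodic omega w /\ (forall t, w t = Phi w t) /\ u = fun t => neg_power T alpha (w t)).
  { eapply (fixed_point_of_mild_solution D A T) with (M := M) (nu := nu) (Mal := Malpha); eassumption. }
  destruct Hfp as [w [Cw [Hw ->]]].
  apply functional_extensionality. intros t. f_equal.
  exact (contraction_unique omega Homega Phi q H3 Hcontr v w Cv Cw Hv Hw t).
Qed.
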